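(* Let $0=s_0<s_1<\cdots<s_k<s_{k+1}=1$ and $\bar{\mathbf{p}}_0$ be fixed. Suppose that for $T=\bar T$ there is an absolutely continuous solution $(\bar{\mathbf{x}},\bar{\mathbf{p}})$ on $[0,1]$ of the coupled system $$\dot{\mathbf{x}}(t)=T\,\mathbf{F}(\mathbf{x}(t),\mathbf{p}(t),t),\qquad \dot{\mathbf{p}}(t)=-T\,\mathbf{p}(t)\mathbf{F}_x(\mathbf{x}(t),\mathbf{p}(t),t),\qquad (\mathbf{x}(0),\mathbf{p}(0))=(\mathbf{x}_0,\bar{\mathbf{p}}_0),$$ and that the Generalized State Regularity property (defined in the context) holds at $(\bar{\mathbf{x}},\bar{\mathbf{p}})$. Let $\mathbf{y}=(\mathbf{y}_1,\mathbf{y}_2):[0,1]\to\mathbb{R}^{2n}$ (a row vector) be the solution of $$\dot{\mathbf{y}}_1(t)=-\bar T\,\nabla_x\mathcal{H}_j(\bar{\mathbf{x}}(t),\bar{\mathbf{p}}(t),\mathbf{y}(t),t),\quad \mathbf{y}_1(1)=\nabla C(\bar{\mathbf{x}}(1)),$$ $$\dot{\mathbf{y}}_2(t)=-\bar T\,\nabla_p\mathcal{H}_j(\bar{\mathbf{x}}(t),\bar{\mathbf{p}}(t),\mathbf{y}(t),t),\quad \mathbf{y}_2(1)=\mathbf{0},$$ on $(s_j,s_{j+1})$ for $j=k,k-1,\dots,0$. Then $$\left.\frac{dC(T)}{dT}\right|_{T=\bar T}=\nabla C(\bar{\mathbf{x}}(1))\left.\frac{d\mathbf{x}(1)}{dT}\right|_{T=\bar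 T}=\int_0^1\mathcal{H}(\bar{\mathbf{x}}(\tau),\bar{\mathbf{p}}(\tau),\mathbf{y}(\tau),\tau)\,d\tau,$$ where $\mathcal{H}(\mathbf{x},\mathbf{p},\mathbf{y},\tau)=\mathcal{H}_j(\mathbf{x},\mathbf{p},\mathbf{y},\tau)$ when $s_j\le\tau\le s_{j+1}$, $0\le j\le k$.
   Context: Setting. This is a free terminal time control problem rescaled to $[0,1]$: minimize $C(\mathbf{x}(1))$ subject to $\dot{\mathbf{x}}=T\mathbf{f}(\mathbf{x},\mathbf{u})$, $\mathbf{x}(0)=\mathbf{x}_0\in\mathbb{R}^n$, where $\mathbf{f}:\mathbb{R}^n\times\mathbb{R}^m\to\mathbb{R}^n$ and $C:\mathbb{R}^n\to\mathbb{R}$ are differentiable. The control has the form $\mathbf{u}=\boldsymbol{\phi}_j(\mathbf{x},\mathbf{p},t)$ on $(s_j,s_{j+1})$, $0\le j\le k$, where $\mathbf{p}$ (a row vector in $\mathbb{R}^n$) is the costate. Define $$\mathbf{f}_j(\mathbf{x},\mathbf{p},t)=\mathbf{f}(\mathbf{x},\boldsymbol{\phi}_j(\mathbf{x},\mathbf{p},t)),\qquad \mathbf{f}_{jx}(\mathbf{x},\mathbf{p},t)=\nabla_x\mathbf{f}(\mathbf{x},\mathbf{u})\big|_{\mathbf{u}=\boldsymbol{\phi}_j(\mathbf{x},\mathbf{p},t)},$$ where $\nabla_x\mathbf{f}(\mathbf{x},\mathbf{u})$ is the Jacobian of $\mathbf{f}$ in its first argument with $\mathbf{u}$ held fixed,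 and set $\mathbf{F}(\mathbf{x},\mathbf{p},t)=\mathbf{f}_j(\mathbf{x},\mathbf{p},t)$, $\mathbf{F}_x(\mathbf{x},\mathbf{p},t)=\mathbf{f}_{jx}(\mathbf{x},\mathbf{p},t)$ for $t\in(s_j,s_{j+1})$. Generalized Hamiltonian: for a row vector $\mathbf{y}=(\mathbf{y}_1,\mathbf{y}_2)\in\mathbb{R}^{2n}$ with $\mathbf{y}_1,\mathbf{y}_2\in\mathbb{R}^n$, $$\mathcal{H}_j(\mathbf{x},\mathbf{p},\mathbf{y},t)=\mathbf{y}_1\mathbf{f}_j(\mathbf{x},\mathbf{p},t)-\mathbf{p}\,\mathbf{f}_{jx}(\mathbf{x},\mathbf{p},t)\,\mathbf{y}_2^{\mathsf T},\qquad 0\le j\le k.$$ $\nabla_x\mathcal{H}_j$ and $\nabla_p\mathcal{H}_j$ are its gradients (row vectors) with respect to $\mathbf{x}$ and $\mathbf{p}$; $\nabla C$ is a row vector. Differential equations hold at almost every $t$, with absolutely continuous solutions. $C(T)$ denotes $C(\mathbf{x}(1))$, where $(\mathbf{x},\mathbf{p})$ solves the coupled system with parameter $T$, the fixed switching points, and the fixed initial condition $(\mathbf{x}_0,\bar{\mathbf{p}}_0)$; $\mathbf{x}(1)$ is regarded as a function of $T$. Generalized State Regularity (at $(\bar{\mathbf{x}},\bar{\mathbf{p}})$). There exist constants $\rho>0$, $s_j^-\in(s_{j-1},s_j)$ and $s_j^+\in(s_j,s_{j+1})$, $1\le j\le k$, such that, with $s_0^-=0$ and $s_{k+1}^+=1$,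 for each $0\le j\le k$ the pair $(\mathbf{f}_j,\mathbf{f}_{jx})$ is continuously differentiable on the tube $\mathcal{T}_j$ consisting of all $(\boldsymbol{\chi},t)$ with $t\in[s_j^-,s_{j+1}^+]$ and $\boldsymbol{\chi}\in\mathbb{R}^{2n}$ in the closed ball of radius $\rho$ centered at $(\bar{\mathbf{x}}(t),\bar{\mathbf{p}}(t))$. Moreover $(\mathbf{f}_j(\boldsymbol{\chi},t),\mathbf{f}_{jx}(\boldsymbol{\chi},t))$ is Lipschitz continuously differentiable with respect to $\boldsymbol{\chi}$ on $\mathcal{T}_j$ (its derivative in $\boldsymbol{\chi}$ is Lipschitz in $\boldsymbol{\chi}$), uniformly in $j$ and $t\in[s_j^-,s_{j+1}^+]$. *)

(* Defs.v *)
From mathcomp Require Import all_boot all_order all_algebra.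
From mathcomp Require Import all_classical all_reals all_analysis.

Set Implicit Arguments.
Unset Strict Implicit.
Unset Printing Implicit Defensive.

Import Order.TTheory GRing.Theory Num.Theory.
Import numFieldNormedType.Exports.

Local Open Scope classical_set_scope.
Local Open Scope ring_scope.

(* States and controls are column vectors, costates are row vectors.  The
   norms are those of the library, i.e., sup norms on matrices and products. *)

(* The library's jacobian is defined on row vectors and is the transpose of
   the usual one. *)
Definition jacobian_col (R : realType) (n l : nat)
    (g : 'cV[R]_n -> 'cV[R]_l) (x : 'cV[R]_n) : 'M[R]_(l, n) :=
  \matrix_(i, j) ('D_(delta_mx j 0) g x) i 0.

Definition grad_col (R : realType) (n : nat)
    (g : 'cV[R]_n -> R) (x : 'cV[R]_n) : 'rV[R]_n :=
  \row_j 'D_(delta_mx j 0) g x.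

Definition grad_row (R : realType) (n : nat)
    (g : 'rV[R]_n -> R) (p : 'rV[R]_n) : 'rV[R]_n :=
  \row_j 'D_(delta_mx 0 j) g p.

(* The i-th interval of the finite family is `]l i, r i[; intervals may be
   empty and may share endpoints. *)
Definition abs_continuous (R : realType) (V : normedModType R)
    (a b : R) (g : R -> V) : Prop :=
  forall e : R, 0 < e -> exists2 d : R, 0 < d &
    forall (N : nat) (l r : 'I_N -> R),
      (forall i, a <= l i /\ l i <= r i /\ r i <= b) ->
      (forall i j, i != j -> r i <= l j \/ r j <= l i) ->
      \sum_(i < N) (r i - l i) < d ->
      \sum_(i < N) `|g (r i) - g (l i)| < e.

(* Fréchet derivative relative to A.  It is unique, and D is determined on A,
   when A is the closure of its interior and D is continuous on A; no
   differentiability across the boundary of A is required. *)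
Definition derivative_on (R : realType) (V W : normedModType R) (A : set V)
    (g : V -> W) (D : V -> {linear V -> W}) : Prop :=
  forall z, A z ->
    let N := within A (nbhs z) in
    (fun z' => g z' - g z - D z (z' - z)) =o_N (fun z' => z' - z).

(* V is meant to be finite-dimensional, where continuity of D z h in z for
   each h is continuity of D for the operator norm. *)
Definition continuously_differentiable_on (R : realType)
    (V W : normedModType R) (A : set V) (g : V -> W)
    (D : V -> {linear V -> W}) : Prop :=
  derivative_on A g D /\ forall h, {within A, continuous (fun z => D z h)}.

Section control.
Context (R : realType) (n m k : nat).
Context (f : 'cV[R]_n -> 'cV[R]_m -> 'cV[R]_n).
Context (phi : nat -> 'cV[R]_n -> 'rV[R]_n -> R -> 'cV[R]_m).
Context (s : nat -> R).

Definition fj (j : nat) (x : 'cV[R]_n) (p : 'rV[R]_n) (t : R) : 'cV[R]_n :=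
  f x (phi j x p t).

(* The control is frozen before differentiating. *)
Definition fjx (j : nat) (x : 'cV[R]_n) (p : 'rV[R]_n) (t : R) : 'M[R]_n :=
  jacobian_col (fun x' => f x' (phi j x p t)) x.

Definition hamiltonian_j (j : nat) (x : 'cV[R]_n) (p : 'rV[R]_n)
    (y : 'rV[R]_n * 'rV[R]_n) (t : R) : R :=
  (y.1 *m fj j x p t - p *m fjx j x p t *m y.2^T) 0 0.

(* On `]s j, s j.+1[ this is j; the choice made at the switching points, a null
   set, is immaterial. *)
Definition stage (t : R) : nat :=
  if [pick j : 'I_k.+1 | s j <= t <= s j.+1] is Some j then val j else 0%N.

Definition F (x : 'cV[R]_n) (p : 'rV[R]_n) (t : R) : 'cV[R]_n :=
  fj (stage t) x p t.

Definition Fx (x : 'cV[R]_n) (p : 'rV[R]_n) (t : R) : 'M[R]_n :=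
  fjx (stage t) x p t.

Definition hamiltonian (x : 'cV[R]_n) (p : 'rV[R]_n)
    (y : 'rV[R]_n * 'rV[R]_n) (t : R) : R :=
  hamiltonian_j (stage t) x p y t.

Definition coupled_solution (x0 : 'cV[R]_n) (p0 : 'rV[R]_n) (T : R)
    (x : R -> 'cV[R]_n) (p : R -> 'rV[R]_n) : Prop :=
  [/\ abs_continuous 0 1 x, abs_continuous 0 1 p, x 0 = x0, p 0 = p0 &
      {ae (@lebesgue_measure R), forall t : R, t \in `[0, 1] ->
         is_derive t 1 x (T *: F (x t) (p t) t) /\
         is_derive t 1 p (- T *: (p t *m Fx (x t) (p t) t))}].

Definition adjoint_solution (C : 'cV[R]_n -> R) (T : R)
    (x : R -> 'cV[R]_n) (p : R -> 'rV[R]_n)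
    (y : R -> 'rV[R]_n * 'rV[R]_n) : Prop :=
  [/\ abs_continuous 0 1 y, (y 1).1 = grad_col C (x 1), (y 1).2 = 0 &
      forall j, (j <= k)%N ->
        {ae (@lebesgue_measure R), forall t : R, t \in `]s j, s j.+1[ ->
           is_derive t 1 (fun t' => (y t').1)
             (- T *: grad_col (fun x' => hamiltonian_j j x' (p t) (y t) t)
                       (x t)) /\
           is_derive t 1 (fun t' => (y t').2)
             (- T *: grad_row (fun p' => hamiltonian_j j (x t) p' (y t) t)
                       (p t))}].

Definition tube (x : R -> 'cV[R]_n) (p : R -> 'rV[R]_n) (rho a b : R) :
    set (('cV[R]_n * 'rV[R]_n) * R) :=
  [set z | a <= z.2 <= b /\ `|z.1 - (x z.2, p z.2)| <= rho].

Definition state_regularity (x : R -> 'cV[R]_n) (p : R -> 'rV[R]_n) : Prop :=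
  exists (rho : R) (sm sp : nat -> R) (L : R),
    [/\ 0 < rho, sm 0%N = 0, sp k.+1 = 1,
        forall j, (1 <= j <= k)%N ->
          s j.-1 < sm j < s j /\ s j < sp j < s j.+1 &
        forall j, (j <= k)%N ->
          let A := tube x p rho (sm j) (sp j.+1) in
          exists D : ('cV[R]_n * 'rV[R]_n) * R ->
              {linear (('cV[R]_n * 'rV[R]_n) * R)%type ->
                 ('cV[R]_n * 'M[R]_n)%type},
            continuously_differentiable_on A
              (fun z => (fj j z.1.1 z.1.2 z.2, fjx j z.1.1 z.1.2 z.2)) D /\
            forall (t : R) (chi chi' h : 'cV[R]_n * 'rV[R]_n),
              A (chi, t) -> A (chi', t) ->
              `|D (chi, t) (h, 0) - D (chi', t) (h, 0)|
                <= L * `|chi - chi'| * `|h|].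

End control.

(* Main.v *)
Require Import Defs.
From HB Require Import structures.
From mathcomp Require Import all_boot all_order all_algebra.
From mathcomp Require Import all_classical all_reals all_analysis.
From mathcomp Require Import measurable_realfun ring lra.

Set Implicit Arguments.
Unset Strict Implicit.
Unset Printing Implicit Defensive.

Import Order.TTheory GRing.Theory Num.Theory.
Import numFieldNormedType.Exports.

Local Open Scope classical_set_scope.
Local Open Scope ring_scope.

(** Write the coupled system as z' = T G(z, t) with z = (x, p) and
    G(z, t) = (F, - p F_x), and let <y, v> = y_1 v_1 + v_2 y_2^T.  The
    generalized Hamiltonian is <y, G(z, t)>, so the adjoint equation says that
    <y', v> = - Tbar <y, G_z v> for every v, where G_z is the derivative of G
    along the reference trajectory zbar ([adjoint_solution_pairing]).  Let z_T
    solve the system with parameter T and put th = T - Tbar.  As z_T - zbar is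
    O(th) (Gronwall) and G has a quadratic Taylor remainder in the tube,
    the terms containing G_z cancel in

      d/dt <y, z_T - zbar> = th <y, G(zbar, t)> + O(th^2).

    The deviation vanishes at 0 and y(1) = (grad C, 0), hence
    grad C (x_T(1) - xbar(1)) = th int_0^1 H + O(th^2)
    ([adjoint_pairing_estimate]), which is the formula once x_T(1) is known to
    be differentiable in T.

    Differentiability comes from completeness: two difference quotients
    (z_T - zbar) / th satisfy the same linear equation up to errors O(th), so
    by Gronwall they are close to each other, i.e. they form a Cauchy family
    ([difference_quotient_cauchy]).  Existence near Tbar is
    Picard iteration started at zbar ([picard_existence]); the same Gronwall
    estimate shows that every solution stays in the tube
    ([solution_deviation]), which gives uniqueness ([solution_unique]).

    All statements on absolutely continuous functions rest on one inequality,
    [abs_continuous_increment]: if g is absolutely continuous, h is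
    nondecreasing and |g'| <= h' almost everywhere, then
    |g(b) - g(a)| <= h(b) - h(a).  Its proof is a local-to-global argument
    ([local_increment]): the exceptional null set is covered by a small open
    set, and the variation of g over that set is added to h.  Integrals appear only as primitives of
    bounded functions continuous off the switching points
    ([primitive_off_finite]). *)

(** * Increments of absolutely continuous functions *)

(** Without the division, derivatives of pairs and products and increments over
    intervals reduce to inequalities between norms. *)
Lemma is_derive_epsP (R : realType) (V : normedModType R) (g : R -> V) (t : R) (v : V) :
  is_derive t 1 g v <->
  forall e, 0 < e -> exists2 d, 0 < d &
    forall s, `|s - t| < d -> `|g s - g t - (s - t) *: v| <= e * `|s - t|.
Proof.
split=> [[dg gv] e e0|H].
  have : h^-1 *: (g (h *: 1 + t) - g t) @[h --> 0^'] --> v.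
    by rewrite -gv; exact: dg.
  move=> /cvgrPdist_le /(_ e e0) [d /= d0 hd]; exists d => // s sd.
  have [->|st] := eqVneq s t; first by rewrite !subrr scale0r subr0 !normr0 mulr0.
  have st0 : s - t != 0 by rewrite subr_eq0.
  have := hd (s - t); rewrite /ball_/= sub0r normrN => /(_ sd st0).
  rewrite [_ *: 1]mulr1 subrK => h1.
  have -> : g s - g t - (s - t) *: v = - ((s - t) *: (v - (s - t)^-1 *: (g s - g t))).
    by rewrite scalerBr scalerA divff// scale1r opprB.
  by rewrite normrN normrZ mulrC ler_wpM2r.
have cv : h^-1 *: (g (h *: 1 + t) - g t) @[h --> 0^'] --> v.
  apply/cvgrPdist_le => e e0; have [d d0 hd] := H e e0.
  exists d => //= h; rewrite /ball_/= sub0r normrN => hd' h0.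
  have := hd (h + t); rewrite addrK => /(_ hd'); rewrite [h *: 1]mulr1 => h1.
  have -> : v - h^-1 *: (g (h + t) - g t) = - (h^-1 *: (g (h + t) - g t - h *: v)).
    by rewrite !scalerBr scalerA mulVf// scale1r [in RHS]opprB.
  rewrite normrN normrZ normfV ler_pdivrMl ?normr_gt0//.
  by rewrite mulrC.
by split; [apply/cvg_ex; exists v | exact/cvg_lim].
Qed.

(** The supremum of the points up to which the inequality holds, starting from
    [a], belongs to this set by the local inequality on its left and cannot be
    smaller than [b] by the local inequality on its right. *)
Lemma local_increment (R : realType) (V : normedModType R) (g : R -> V)
    (h : R -> R) (a b : R) : a <= b ->
  (forall t, a <= t -> t <= b -> exists2 d, 0 < d & forall u v, a <= u -> u <= t ->
     t <= v -> v <= b -> v - u < d -> `|g v - g u| <= h v - h u) ->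
  `|g b - g a| <= h b - h a.
Proof.
move=> ab H.
pose S := [set t | [/\ a <= t, t <= b & `|g t - g a| <= h t - h a]].
have Sa : S a by split => //; rewrite !subrr normr0.
have hS : has_sup S by split; [exists a|exists b => t []].
pose c := sup S.
have ac : a <= c by apply: sup_upper_bound.
have cb : c <= b by apply: ge_sup; [exists a|move=> t []].
have [d d0 hd] := H c ac cb.
have [t [at_ tb gt] ct] := sup_adherent d0 hS; rewrite -/c in ct.
have tc : t <= c by apply: sup_upper_bound.
have tri x y z : `|g z - g x| <= `|g z - g y| + `|g y - g x|.
  by rewrite -[g z - _](subrKA (g y)) ler_normD.
have gc : `|g c - g a| <= h c - h a.
  have h1 : `|g c - g t| <= h c - h t by apply: hd => //; lra.
  by have := tri a t c; lra.
pose v := Num.min b (c + d / 2).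
have [vb vc] : v <= b /\ v <= c + d / 2 by rewrite !ge_min !lexx orbT.
have cv : c <= v by rewrite le_min cb; lra.
have gv : `|g v - g a| <= h v - h a.
  have h1 : `|g v - g c| <= h v - h c by apply: hd => //; lra.
  by have := tri a c v; lra.
have vc' : v <= c by apply: sup_upper_bound => //; split => //; lra.
suff -> : b = v by [].
by apply/eqP; rewrite eq_le vb andbT /v le_min lexx /=; move: vc'; rewrite /v ge_min; lra.
Qed.

Definition nonoverlapping_in (R : realType) (a t : R) (U : set R) (N : nat) (l r : 'I_N -> R) :=
  [/\ forall i, a <= l i /\ l i <= r i /\ r i <= t,
      forall i j, i != j -> r i <= l j \/ r j <= l i &
      forall i, `]l i, r i[ `<=` U].

Lemma family_length_le (R : realType) (a t : R) (U : set R) (N : nat) (l r : 'I_N -> R) (d : R) :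
  open U -> (lebesgue_measure U < d%:E)%E -> nonoverlapping_in a t U l r ->
  \sum_(i < N) (r i - l i) < d.
Proof.
move=> oU Ud [ltr dis sub]; rewrite -lte_fin; apply: le_lt_trans Ud.
rewrite -sumEFin.
have -> : (\sum_(i < N) (r i - l i)%:E =
    lebesgue_measure (\big[setU/set0]_(i < N) `]l i, r i[%classic))%E.
  rewrite measure_bigsetU_ord//.
    apply: eq_bigr => i _; rewrite [RHS]lebesgue_measure_itv/= lte_fin.
    have [_ [lr _]] := ltr i; case: ltP => // rl.
    by have -> : r i = l i by [apply/eqP; rewrite eq_le lr rl]; rewrite subrr.
  apply/trivIsetP => i j _ _ ij; apply/seteqP; split => // x [] /=.
  by rewrite !in_itv /= => /andP[a1 a2] /andP[a3 a4]; have := dis i j ij; lra.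
apply: le_measure; rewrite ?inE.
- by apply: bigsetU_measurable.
- exact: open_measurable.
- by elim/big_ind: _ => [|A B AU BU x [/AU|/BU]|i _].
Qed.

Definition variation_sums (R : realType) (V : normedModType R) (g : R -> V)
    (a : R) (U : set R) (t : R) : set R :=
  [set q | exists (N : nat) (l r : 'I_N -> R), nonoverlapping_in a t U l r /\
     q = \sum_(i < N) `|g (r i) - g (l i)|].

Definition local_variation (R : realType) (V : normedModType R) (g : R -> V)
    (a : R) (U : set R) (t : R) : R := sup (variation_sums g a U t).

(** Choose an open set U containing Z whose measure is below the modulus of
    absolute continuity of [g] for [e].  The variation of [g] over intervals
    inside U to the left of t is superadditive in t, hence monotone and larger
    than each increment of [g] across an interval inside U; by absolute
    continuity its total is at most [e]. *)
Lemma abs_continuous_null_majorant (R : realType) (V : normedModType R) (g : R -> V)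
    (a b : R) (Z : set R) (e : R) :
  a <= b -> abs_continuous a b g -> (@lebesgue_measure R).-negligible Z -> 0 < e ->
  exists w : R -> R, [/\ forall u v, a <= u -> u <= v -> v <= b -> w u <= w v,
    w b - w a <= e &
    forall t, Z t -> exists2 d, 0 < d & forall u v, a <= u -> u <= t -> t <= v ->
      v <= b -> v - u < d -> `|g v - g u| <= w v - w u].
Proof.
move=> ab gac [A [mA A0 ZA]] e0.
have [d d0 gd] := gac e e0.
have [|U [oU AU Ud]] := @lebesgue_regularity_outer R A d mA _ d0.
  by rewrite [X in (X < _)%E]A0.
have mU : (lebesgue_measure U < d%:E)%E.
  rewrite -(setDUK AU); apply: le_lt_trans Ud.
  apply: le_trans (measureU2 _ _ _) _ => //.
    by apply: measurableD => //; exact: open_measurable.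
  by rewrite [X in (X + _)%E]A0 add0e.
pose S := variation_sums g a U.
have S0 t : S t 0.
  exists 0%N, (fun=> 0), (fun=> 0); split; last by rewrite big_ord0.
  by split => [[]|[]|[]].
have Se t q : t <= b -> S t q -> q <= e.
  move=> tb [N [l [r [lr ->]]]]; apply/ltW/gd.
  - by case: lr => lr _ _ i; have := lr i; lra.
  - by case: lr.
  - exact: family_length_le mU lr.
have supS t : t <= b -> has_sup (S t).
  by move=> tb; split; [exists 0|exists e => q; exact: Se].
exists (local_variation g a U); split.
- move=> u v au uv vb; apply: ge_sup; first by exists 0; exact: S0.
  move=> q [N [l [r [[lr dis lU] ->]]]]; apply: sup_upper_bound; first exact: supS.
  by exists N, l, r; split => //; split => // i; have := lr i; lra.
- have : local_variation g a U b <= e by apply: ge_sup => [|q]; [exists 0; exact: S0|exact: Se].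
  have : 0 <= local_variation g a U a by apply: sup_upper_bound; [exact: supS|exact: S0].
  lra.
move=> t Zt; have /oU := AU _ (ZA _ Zt).
move=> /nbhs_ballP[c /= c0 cU]; exists c => // u v au ut tv vb vuc.
have uvU : `]u, v[ `<=` U.
  move=> x /=; rewrite in_itv/= => /andP[ux xv]; apply: cU.
  by rewrite /ball/= ltr_norml; lra.
rewrite lerBrDr addrC -lerBrDr; apply: ge_sup; first by exists 0; exact: S0.
move=> q [N [l [r [[lr dis lU] ->]]]].
rewrite lerBrDr; apply: sup_upper_bound; first exact: supS.
(* The interval from u to v extends any family lying to the left of u. *)
pose l' (i : 'I_N.+1) := if unlift ord0 i is Some j then l j else u.
pose r' (i : 'I_N.+1) := if unlift ord0 i is Some j then r j else v.
exists N.+1, l', r'; split.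
  split => [i|i j|i]; rewrite /l' /r'.
  - by case: unliftP => [j _|_]; [have := lr j; lra|lra].
  - case: unliftP => [i' ->|->]; case: unliftP => [j' ->|->] ij.
    + by apply: dis; apply: contra ij => /eqP ->.
    + by have := lr i'; lra.
    + by have := lr j'; lra.
    + by rewrite eqxx in ij.
  - by case: unliftP.
rewrite big_ord_recl /l' /r' unlift_none addrC; congr (_ + _).
by apply: eq_bigr => i _; rewrite liftK.
Qed.

(** The increment inequality is local for h + w + e t, where w majorizes [g] on
    the exceptional null set: there w dominates the increments of [g], and
    elsewhere e t absorbs the errors of the two first-order expansions.
    At the exceptional points the increments of [h] only help, by monotonicity. *)
Lemma abs_continuous_increment (R : realType) (V : normedModType R) (g : R -> V)
    (h : R -> R) (a b : R) : a <= b -> abs_continuous a b g ->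
  (forall u v, a <= u -> u <= v -> v <= b -> h u <= h v) ->
  {ae (@lebesgue_measure R), forall t, t \in `[a, b] ->
    exists dg dh, [/\ is_derive t 1 g dg, is_derive t 1 h dh & `|dg| <= dh]} ->
  `|g b - g a| <= h b - h a.
Proof.
move=> ab gac hm gh; apply/ler_addgt0Pr => e0 e0_gt0.
(* The total slack is e + e (b - a). *)
pose e := e0 / (1 + (b - a)).
have e_gt0 : 0 < e by apply: divr_gt0 => //; lra.
have [w [wm we wZ]] := abs_continuous_null_majorant ab gac gh e_gt0.
have : `|g b - g a| <= (h b + w b + e * b) - (h a + w a + e * a).
  apply: (@local_increment _ _ _ (fun t => h t + w t + e * t)) => // t at_ tb.
  have [Zt|Zt] := pselect (exists dg dh, [/\ is_derive t 1 g dg, is_derive t 1 h dh & `|dg| <= dh]).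
    have [dg [dh [/is_derive_epsP Dg /is_derive_epsP Dh dgh]]] := Zt.
    have e2 : 0 < e / 2 by rewrite divr_gt0.
    have [d1 d10 H1] := Dg _ e2; have [d2 d20 H2] := Dh _ e2.
    exists (Num.min d1 d2); first by rewrite lt_min d10.
    move=> u v au ut tv vb; rewrite lt_min => /andP[uv1 uv2].
    have ev : `|v - t| = v - t by rewrite ger0_norm //; lra.
    have eu : `|u - t| = t - u by rewrite ler0_norm; lra.
    have := H1 v; have := H1 u; have := H2 v; have := H2 u.
    rewrite ev eu => /(_ ltac:(lra)) h2u /(_ ltac:(lra)) h2v /(_ ltac:(lra)) h1u /(_ ltac:(lra)) h1v.
    have -> : g v - g u = (g v - g t - (v - t) *: dg) - (g u - g t - (u - t) *: dg) + (v - u) *: dg.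
      have -> : (v - u) *: dg = (v - t) *: dg - (u - t) *: dg.
        by rewrite -scalerBl opprB addrA subrK.
      rewrite !opprD !opprK !addrA [RHS](ACl (1*4*(2*5)*(3*7)*(6*8)))/=.
      by rewrite !addNr subrr !addr0.
    apply: le_trans (ler_normD _ _) _; rewrite normrZ (ger0_norm (_ : 0 <= v - u)); last lra.
    apply: le_trans (lerD (ler_normB _ _) (lexx _)) _.
    have wuv : w u <= w v by apply: wm => //; lra.
    have : (v - u) * `|dg| <= (v - u) * dh by apply: ler_wpM2l => //; lra.
    move: h2u h2v; rewrite !ler_norml => /andP[_ h2u] /andP[h2v _].
    rewrite /GRing.scale/= in h2u h2v; lra.
  have [|d d0 Hd] := wZ t; first by rewrite /= => H; apply: Zt; apply: H; rewrite in_itv/= at_ tb.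
  exists d => // u v au ut tv vb uv; have := Hd u v au ut tv vb uv.
  have := hm u v au ltac:(lra) vb.
  have : e * u <= e * v by rewrite ler_pM2l//; lra.
  lra.
have -> : e0 = e + e * (b - a) by rewrite /e; field; lra.
rewrite mulrBr; lra.
Qed.

Lemma ae_mono (R : realType) (P Q : R -> Prop) :
  (forall t, P t -> Q t) -> {ae (@lebesgue_measure R), forall t, P t} ->
  {ae (@lebesgue_measure R), forall t, Q t}.
Proof.
move=> PQ; apply: negligibleS => t /= nQ /PQ; exact.
Qed.
Lemma ae_and (R : realType) (P Q : R -> Prop) :
  {ae (@lebesgue_measure R), forall t, P t} -> {ae (@lebesgue_measure R), forall t, Q t} ->
  {ae (@lebesgue_measure R), forall t, P t /\ Q t}.
Proof.
move=> hP hQ; have := negligibleU hP hQ; apply: negligibleS => t /= /not_andP.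
by [].
Qed.

(** * Closure properties and the Gronwall inequality *)

Lemma is_derive_scaled_expR (R : realType) (a c t : R) :
  is_derive t 1 (fun t => a * expR (c * t)) (a * (c * expR (c * t))).
Proof.
have dct : is_derive t 1 ( *%R c) c.
  by apply: is_derive_eq; rewrite /GRing.scale/= mulr1.
have dec : is_derive t 1 (fun t => expR (c * t)) (c * expR (c * t)).
  apply: (@is_derive_eq _ _ _ (expR \o *%R c)).
  by rewrite mulrC.
exact: (@is_deriveZ _ _ _ (fun t => expR (c * t))).
Qed.

Lemma abs_continuous_unif (R : realType) (V : normedModType R) (g : R -> V) (a b : R) :
  abs_continuous a b g -> forall e, 0 < e -> exists2 d, 0 < d &
    forall u v, a <= u -> u <= v -> v <= b -> v - u < d -> `|g v - g u| < e.
Proof.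
move=> gac e e0; have [d d0 gd] := gac e e0; exists d => // u v au uv vb uvd.
have := gd 1%N (fun=> u) (fun=> v); rewrite !big_ord1; apply => // i j.
by rewrite !ord1 eqxx.
Qed.

Lemma abs_continuousS (R : realType) (V : normedModType R) (g : R -> V) (a b c d : R) :
  a <= c -> d <= b -> abs_continuous a b g -> abs_continuous c d g.
Proof.
move=> ac db gac e e0; have [del del0 gd] := gac e e0; exists del => //.
by move=> N l r lr; apply: gd => i; have := lr i; lra.
Qed.

(** All closure properties of absolute continuity used below (differences,
    scalings, pairs, projections, products of bounded functions) are instances. *)
Lemma abs_continuous_dom (R : realType) (V V1 V2 : normedModType R) (g : R -> V)
    (g1 : R -> V1) (g2 : R -> V2) (K a b : R) :
  abs_continuous a b g1 -> abs_continuous a b g2 ->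
  (forall u v, a <= u -> u <= v -> v <= b ->
     `|g v - g u| <= K * (`|g1 v - g1 u| + `|g2 v - g2 u|)) ->
  abs_continuous a b g.
Proof.
move=> ac1 ac2 H e e0.
pose M := `|K| + 1; have M0 : 0 < M by rewrite /M ltr_wpDl.
pose e' := e / (2 * M); have e'0 : 0 < e' by rewrite divr_gt0// mulr_gt0.
have [d1 d10 H1] := ac1 _ e'0; have [d2 d20 H2] := ac2 _ e'0.
exists (Num.min d1 d2); first by rewrite lt_min d10.
move=> N l r lr dis; rewrite lt_min => /andP[L1 L2].
have h1 := H1 N l r lr dis L1; have h2 := H2 N l r lr dis L2.
apply: (@le_lt_trans _ _ (M * (\sum_(i < N) `|g1 (r i) - g1 (l i)| + \sum_(i < N) `|g2 (r i) - g2 (l i)|))).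
  rewrite -big_split/= mulr_sumr; apply: ler_sum => i _.
  apply: le_trans (H _ _ _ _ _) _; [by have := lr i; lra..|].
  apply: ler_wpM2r; first by rewrite addr_ge0.
  by rewrite /M (le_trans (ler_norm K))// lerDl.
have -> : e = M * (e' + e') by rewrite /e'; field; lra.
by rewrite ltr_pM2l// ltrD.
Qed.

Lemma lipschitz_abs_continuous (R : realType) (V : normedModType R) (g : R -> V) (K a b : R) :
  (forall u v, a <= u -> u <= v -> v <= b -> `|g v - g u| <= K * (v - u)) ->
  abs_continuous a b g.
Proof.
move=> H; pose id' (t : R) : R := t.
have idac : abs_continuous a b id'.
  move=> e e0; exists e => // N l r lr _ sd.
  rewrite (eq_bigr (fun i => r i - l i))// => i _.
  by rewrite /id' ger0_norm//; have := lr i; lra.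
apply: (@abs_continuous_dom _ _ _ _ g id' id' K) => // u v au uv vb.
have Ki : K <= `|K| by apply: ler_norm.
have := H u v au uv vb; rewrite /id' (ger0_norm (_ : 0 <= v - u)); last lra.
move=> gK; have : 0 <= K * (v - u) by apply: le_trans gK.
by rewrite mulrDr; lra.
Qed.

(** Let S be the set of times up to which the bound holds.  On S the bound
    improves by [a], and uniform continuity of [w] then extends S by a fixed
    step, so S reaches 1.  Since the derivative is controlled only where the
    bound holds, the lemma also shows that a trajectory stays in a tube on
    which its equation is understood. *)
Lemma gronwall (R : realType) (V : normedModType R) (w : R -> V) (a b : R) :
  0 < a -> 0 <= b -> abs_continuous 0 1 w -> w 0 = 0 ->
  {ae (@lebesgue_measure R), forall t, t \in `[0, 1] ->
    `|w t| <= a * expR ((b + 1) * t) ->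
    exists2 dw, is_derive t 1 w dw & `|dw| <= a + b * `|w t|} ->
  forall t, 0 <= t -> t <= 1 -> `|w t| <= a * expR ((b + 1) * t).
Proof.
move=> a0 b0 wac w0 dw.
pose h t := a * expR ((b + 1) * t).
have hm u v : u <= v -> h u <= h v.
  by move=> uv; rewrite /h ler_pM2l// ler_expR ler_pM2l//; lra.
have h0 : h 0 = a by rewrite /h mulr0 expR0 mulr1.
have ha t : 0 <= t -> a <= h t by move=> t0; rewrite -h0; exact: hm.
pose S := [set t | [/\ 0 <= t, t <= 1 & forall s, 0 <= s -> s <= t -> `|w s| <= h s]].
(* Below the bound, the increment inequality gains the margin a. *)
have better t : S t -> `|w t| <= h t - a.
  move=> [t0 t1 St]; rewrite -h0 -[w t]subr0 -w0.
  apply: abs_continuous_increment => //; first exact: abs_continuousS wac.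
    by move=> u v _ uv _; exact: hm.
  move: dw; apply: ae_mono => u Hu; rewrite in_itv/= => /andP[u0 ut].
  have [||dwu d1 d2] := Hu; [by rewrite in_itv/= u0; lra|exact: St|].
  exists dwu, (a * ((b + 1) * h u / a)); split => //.
    by rewrite /h -mulrA [_ / _]mulrAC divff ?gt_eqF// mul1r; exact: is_derive_scaled_expR.
  apply: le_trans d2 _; have -> : a * ((b + 1) * h u / a) = h u + b * h u by field; lra.
  by rewrite lerD ?ha// ler_wpM2l// St.
have S0 : S 0.
  by split => // s s0 s0'; have -> : s = 0 by [lra]; rewrite w0 normr0 h0 ltW.
have hS : has_sup S by split; [exists 0|exists 1 => t []].
have [d d0 wd] := abs_continuous_unif wac a0.
have d20 : 0 < d / 2 by rewrite divr_gt0.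
have [t St ct] := sup_adherent d20 hS.
have [t0 t1 Sts] := St; pose v := Num.min 1 (t + d * (3 / 4)).
have [v1 vc] : v <= 1 /\ v <= t + d * (3 / 4) by rewrite !ge_min !lexx orbT.
have tv : t <= v by rewrite le_min t1; lra.
have Sv : S v.
  split; [lra..|] => s s0 sv.
  have [st|ts] := leP s t; first exact: Sts.
  have h1 := better t St.
  have h2 : `|w s - w t| < a by apply: wd => //; lra.
  have h3 : h t <= h s by apply: hm; lra.
  have := ler_normD (w s - w t) (w t); rewrite subrK; lra.
have vc' : v <= sup S by apply: sup_upper_bound.
have v1' : v = 1.
  by apply/eqP; rewrite eq_le v1 /v le_min lexx/=; move: vc'; rewrite /v ge_min; lra.
by case: Sv; rewrite v1' => _ _ H t' t'0 t'1; exact: H.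
Qed.

(** * Regular vector fields: deviation, linearization, existence *)

(** Completeness for sequences converging at the rate of a Picard iteration;
    in this form it passes to products coordinatewise, with the same rate. *)
Definition complete_for_halving (R : realType) (V : normedModType R) : Prop :=
  forall (u : nat -> V) (K : R),
    (forall i m, `|u (i + m)%N - u i| <= K * 2^-1 ^+ i) ->
    exists l, forall i, `|l - u i| <= K * 2^-1 ^+ i.

Lemma halving_small (R : realType) (K e : R) : 0 < e ->
  exists N, forall i, (N <= i)%N -> `|K * 2^-1 ^+ i| < e.
Proof.
move=> e0; have half1 : `|2^-1 : R| < 1 by rewrite ger0_norm; lra.
have /cvgrPdist_lt /(_ e e0) [N _ HN] := cvg_geometric K half1.
by exists N => i Ni; have := HN i Ni; rewrite /= /geometric/= sub0r normrN.
Qed.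

Lemma le_halving (R : realType) (x y K : R) :
  (forall i, x <= y + K * 2^-1 ^+ i) -> x <= y.
Proof.
move=> H; apply/ler_addgt0Pr => e e0; have [N HN] := halving_small K e0.
have := H N; have := HN N (leqnn N); have := ler_norm (K * 2^-1 ^+ N); lra.
Qed.

Lemma complete_for_halvingT (R : realType) (V : completeNormedModType R) :
  complete_for_halving V.
Proof.
move=> u K H.
have cu : cauchy (u @ \oo).
  apply/cauchyP => e e0; have [N HN] := halving_small K e0.
  exists (u N); exists N => // n Nn; rewrite /= -ball_normE/= distrC -(subnKC Nn).
  apply: le_lt_trans (H N _) _; apply: le_lt_trans (ler_norm _) _; exact: HN.
have /cauchy_cvgP/cvg_ex[l ul] := cu; exists l => i.
apply/ler_addgt0Pr => e e0.
have /cvgrPdist_lt /(_ e e0) [N _ HN] := ul.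
have := HN (i + N)%N (leq_addl _ _); have := H i N.
have := ler_normD (l - u (i + N)%N) (u (i + N)%N - u i); rewrite subrKA; lra.
Qed.

Lemma complete_for_halving_prod (R : realType) (V W : normedModType R) :
  complete_for_halving V -> complete_for_halving W -> complete_for_halving (V * W)%type.
Proof.
move=> cV cW u K H.
have [|l1 H1] := cV (fun i => (u i).1) K.
  by move=> i m; apply: le_trans (H i m); rewrite prod_normE/= le_max lexx.
have [|l2 H2] := cW (fun i => (u i).2) K.
  by move=> i m; apply: le_trans (H i m); rewrite prod_normE/= le_max lexx orbT.
by exists (l1, l2) => i; rewrite prod_normE/= ge_max H1 H2.
Qed.

(** The properties of a time-dependent field near a curve [z] on which the
    parameter sensitivity depends.  [A t] is the derivative of [G] at [z t];
    [rf_taylor] says so with a quadratic remainder.  [rf_prim] is the integral of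
    [G] along a curve, in the form of an antiderivative. *)
Record regular_field (R : realType) (V : normedModType R) (G : V -> R -> V)
    (z : R -> V) (A : R -> {linear V -> V}) (rho L M : R) : Prop := RegularField {
  rf_rho : 0 < rho;
  rf_L : 0 <= L;
  rf_M : 0 <= M;
  rf_lip : forall (t : R) v w, 0 <= t -> t <= 1 -> `|v - z t| <= rho -> `|w - z t| <= rho ->
    `|G v t - G w t| <= L * `|v - w|;
  rf_taylor : forall (t : R) v, 0 <= t -> t <= 1 -> `|v - z t| <= rho ->
    `|G v t - G (z t) t - A t (v - z t)| <= L * `|v - z t| ^+ 2;
  rf_bound : forall t : R, 0 <= t -> t <= 1 -> `|G (z t) t| <= M;
  rf_lin : forall (t : R) v, 0 <= t -> t <= 1 -> `|A t v| <= L * `|v|;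
  rf_prim : forall (u : R -> V) (K : R),
    (forall s t : R, 0 <= s -> s <= t -> t <= 1 -> `|u t - u s| <= K * (t - s)) ->
    (forall t : R, 0 <= t -> t <= 1 -> `|u t - z t| <= rho) ->
    exists P : R -> V, [/\ abs_continuous 0 1 P, P 0 = 0 &
      {ae (@lebesgue_measure R), forall t : R, t \in `[0, 1] ->
         is_derive t 1 P (G (u t) t)}] }.

Definition ode_solution (R : realType) (V : normedModType R) (G : V -> R -> V)
    (z0 : V) (T : R) (u : R -> V) : Prop :=
  [/\ abs_continuous 0 1 u, u 0 = z0 &
    {ae (@lebesgue_measure R), forall t : R, t \in `[0, 1] ->
       is_derive t 1 u (T *: G (u t) t)}].

Section ode.
Context (R : realType) (V : normedModType R) (G : V -> R -> V) (z : R -> V)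
  (A : R -> {linear V -> V}) (rho L M Tbar : R).
Context (rf : regular_field G z A rho L M).
Context (zsol : ode_solution G (z 0) Tbar z).

Let B : R := `|Tbar| + 1.
Let b : R := B * L.
Let kappa : R := expR (b + 1).

Let L0 : 0 <= L := rf_L rf.
Let M0 : 0 <= M := rf_M rf.
Let B0 : 0 <= B. Proof. by rewrite addr_ge0. Qed.
Let b0 : 0 <= b. Proof. exact: mulr_ge0. Qed.
Let lam0 : 0 < b + 1. Proof. by rewrite ltr_wpDl. Qed.

(** Bounds the growth of deviations for all parameters T with
    |T| <= |Tbar| + 1. *)
Definition gronwall_factor : R := expR ((`|Tbar| + 1) * L + 1).

Let exp_le_kappa t : t <= 1 -> expR ((b + 1) * t) <= kappa.
Proof. by move=> t1; rewrite ler_expR ler_piMr// ltW. Qed.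

Lemma abs_continuousB (u v : R -> V) a c : abs_continuous a c u -> abs_continuous a c v ->
  abs_continuous a c (fun t => u t - v t).
Proof.
move=> ac1 ac2; apply: (@abs_continuous_dom _ _ _ _ _ u v 1) => // s t _ _ _.
rewrite mul1r; have -> : u t - v t - (u s - v s) = (u t - u s) - (v t - v s).
  by rewrite !opprB !addrA [LHS](ACl (1*4*3*2))/=.
exact: ler_normB.
Qed.

(** The deviation w from [z] satisfies |w'| <= |T - Tbar| M + |T| L |w| as long
    as it stays in the ball of radius [rho], and the bound that Gronwall gives
    is at most [rho]. *)
Lemma solution_deviation T u a : `|T| <= B -> 0 < a -> `|T - Tbar| * M <= a ->
  a * gronwall_factor <= rho -> ode_solution G (z 0) T u ->
  forall t, 0 <= t -> t <= 1 -> `|u t - z t| <= a * gronwall_factor.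
Proof.
move=> TB a0 Ta arho [uac u0 du] t t0 t1.
have [zac _ dz] := zsol.
apply: (@le_trans _ _ (a * expR ((b + 1) * t))); last by rewrite ler_pM2l// exp_le_kappa.
apply: (@gronwall _ _ (fun t => u t - z t) a b) => //.
- exact: abs_continuousB.
- by rewrite u0 subrr.
have := ae_and du dz; apply: ae_mono => s [dus dzs] s01 wrho.
have := s01; rewrite in_itv/= => /andP[s0 s1].
have srho : `|u s - z s| <= rho.
  apply: le_trans wrho _; apply: le_trans arho.
  by rewrite ler_pM2l// exp_le_kappa.
exists (T *: G (u s) s - Tbar *: G (z s) s).
  by apply: is_deriveB; [exact: dus|exact: dzs].
have -> : T *: G (u s) s - Tbar *: G (z s) s =
    (T - Tbar) *: G (z s) s + T *: (G (u s) s - G (z s) s).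
  by rewrite scalerBl scalerBr !addrA [RHS](ACl (3*2*(1*4)))/= subrr addr0.
apply: le_trans (ler_normD _ _) _; rewrite !normrZ; apply: lerD.
  by apply: le_trans Ta; rewrite ler_wpM2l// (rf_bound rf).
rewrite /b -mulrA; apply: ler_pM => //; apply: (rf_lip rf) => //.
by rewrite subrr normr0 ltW// (rf_rho rf).
Qed.

(** For every a > 0, the difference w of the two solutions satisfies
    |w'| <= a + |T| L |w|, so that Gronwall bounds it by a multiple of a. *)
Lemma solution_unique T u v : `|T| <= B ->
  ode_solution G (z 0) T u -> ode_solution G (z 0) T v ->
  (forall t, 0 <= t -> t <= 1 -> `|u t - z t| <= rho) ->
  (forall t, 0 <= t -> t <= 1 -> `|v t - z t| <= rho) ->
  forall t, 0 <= t -> t <= 1 -> u t = v t.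
Proof.
move=> TB [uac u0 du] [vac v0 dv] urho vrho t t0 t1.
apply/eqP; rewrite -subr_eq0 -normr_eq0; apply/eqP/le_anti; rewrite normr_ge0 andbT.
apply/ler_addgt0Pr => e e0; rewrite add0r.
have a0 : 0 < e / kappa by rewrite divr_gt0// expR_gt0.
apply: (@le_trans _ _ (e / kappa * expR ((b + 1) * t))); last first.
  by rewrite -[leRHS](divfK (lt0r_neq0 (expR_gt0 (b + 1)))) ler_pM2l// exp_le_kappa.
apply: (@gronwall _ _ (fun t => u t - v t)) => //.
- exact: abs_continuousB.
- by rewrite u0 v0 subrr.
have := ae_and du dv; apply: ae_mono => s [dus dvs] s01 wrho.
have := s01; rewrite in_itv/= => /andP[s0 s1].
exists (T *: G (u s) s - T *: G (v s) s).
  by apply: is_deriveB; [exact: dus|exact: dvs].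
rewrite -scalerBr normrZ; apply: ler_wpDl; first exact: ltW.
rewrite /b -mulrA; apply: ler_pM => //; apply: (rf_lip rf) => //; [exact: urho|exact: vrho].
Qed.

(** With c |T - Tbar| a bound for the deviation, the two terms come from the
    Lipschitz bound times |T - Tbar| and from the Taylor remainder. *)
Definition second_order_constant : R :=
  let c := (M + 1) * gronwall_factor in L * c + `|Tbar| * L * c ^+ 2.

(** T G(u) - Tbar G(z) - (T - Tbar) G(z) - Tbar A (u - z) equals
    (T - Tbar) (G(u) - G(z)) + Tbar (G(u) - G(z) - A (u - z)), and both terms
    are quadratic in T - Tbar because u - z is O(T - Tbar). *)
Lemma solution_linearization T u : `|T| <= B ->
  `|T - Tbar| * (M + 1) * gronwall_factor <= rho -> T != Tbar -> ode_solution G (z 0) T u ->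
  {ae (@lebesgue_measure R), forall t : R, t \in `[0, 1] ->
    exists2 dw, is_derive t 1 (fun t => u t - z t) dw &
    `|dw - (T - Tbar) *: G (z t) t - Tbar *: A t (u t - z t)| <=
      second_order_constant * `|T - Tbar| ^+ 2}.
Proof.
move=> TB Trho TT usol.
have th0 : 0 < `|T - Tbar| by rewrite normr_gt0 subr_eq0.
have dev t : 0 <= t -> t <= 1 ->  `|u t - z t| <= `|T - Tbar| * (M + 1) * gronwall_factor.
  apply: (@solution_deviation T u) => //; first by rewrite mulr_gt0// ltr_wpDl.
  by rewrite ler_wpM2l// lerDl.
have [_ _ du] := usol; have [_ _ dz] := zsol.
have := ae_and du dz; apply: ae_mono => s [dus dzs] s01.
have := s01; rewrite in_itv/= => /andP[s0 s1].
exists (T *: G (u s) s - Tbar *: G (z s) s).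
  by apply: is_deriveB; [exact: dus|exact: dzs].
have -> : T *: G (u s) s - Tbar *: G (z s) s - (T - Tbar) *: G (z s) s - Tbar *: A s (u s - z s)
  = (T - Tbar) *: (G (u s) s - G (z s) s) + Tbar *: (G (u s) s - G (z s) s - A s (u s - z s)).
  rewrite [_ *: (G (u s) s - _ - _)]scalerBr [RHS]addrA -[in RHS]scalerDl subrK.
  by rewrite [(T - Tbar) *: G (z s) s]scalerBl opprB addrA subrK -scalerBr.
have us := dev s s0 s1; have usrho := le_trans us Trho.
set w := `|u s - z s| in us.
have w0 : 0 <= w by exact: normr_ge0.
pose c := (M + 1) * gronwall_factor; have c0 : 0 <= c.
  by rewrite mulr_ge0 ?addr_ge0 ?expR_ge0.
have wc : w <= `|T - Tbar| * c by rewrite /c mulrA.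
apply: le_trans (ler_normD _ _) _; rewrite !normrZ.
have h1 : `|G (u s) s - G (z s) s| <= L * w.
  by apply: (rf_lip rf) => //; rewrite subrr normr0 ltW// (rf_rho rf).
have h2 : `|G (u s) s - G (z s) s - A s (u s - z s)| <= L * w ^+ 2 by apply: (rf_taylor rf).
have h3 : w ^+ 2 <= (`|T - Tbar| * c) ^+ 2 by rewrite lerXn2r// nnegrE mulr_ge0.
have -> : second_order_constant * `|T - Tbar| ^+ 2 =
    `|T - Tbar| * (L * (`|T - Tbar| * c)) + `|Tbar| * (L * (`|T - Tbar| * c) ^+ 2).
  by rewrite /second_order_constant -/c; ring.
apply: lerD; apply: ler_wpM2l => //; [apply: le_trans h1 _|apply: le_trans h2 _]; exact: ler_wpM2l.
Qed.

Section picard.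
Context (T a : R) (TB : `|T| <= B) (a0 : 0 < a) (Ta : `|T - Tbar| * M <= a)
  (arho : a * gronwall_factor <= rho).

Let K1 : R := B * (M + L * rho).

Let admissible (u : R -> V) :=
  (forall s t, 0 <= s -> s <= t -> t <= 1 -> `|u t - u s| <= K1 * (t - s)) /\
  (forall t, 0 <= t -> t <= 1 -> `|u t - z t| <= a * expR ((b + 1) * t)).

Let picard_rel (u v : R -> V) :=
  [/\ abs_continuous 0 1 v, v 0 = z 0 &
    {ae (@lebesgue_measure R), forall t : R, t \in `[0, 1] -> is_derive t 1 v (T *: G (u t) t)}].

Let admissible_tube u t : admissible u -> 0 <= t -> t <= 1 -> `|u t - z t| <= rho.
Proof.
move=> [_ ut] t0 t1; apply: le_trans (ut t t0 t1) _; apply: le_trans arho.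
by rewrite ler_pM2l// exp_le_kappa.
Qed.

Let lipschitz_of_deriv T' (u v : R -> V) : `|T'| <= B -> abs_continuous 0 1 v ->
  (forall t, 0 <= t -> t <= 1 -> `|u t - z t| <= rho) ->
  {ae (@lebesgue_measure R), forall t : R, t \in `[0, 1] -> is_derive t 1 v (T' *: G (u t) t)} ->
  forall s t, 0 <= s -> s <= t -> t <= 1 -> `|v t - v s| <= K1 * (t - s).
Proof.
move=> TB' vac urho dv s t s0 st t1; rewrite mulrBr.
have rho0 := ltW (rf_rho rf).
have K10 : 0 <= K1 by rewrite mulr_ge0// addr_ge0// mulr_ge0.
apply: (@abs_continuous_increment _ _ v ( *%R K1)) => //.
- exact: abs_continuousS vac.
- by move=> *; apply: ler_wpM2l.
apply: ae_mono dv => x dvx; rewrite in_itv/= => /andP[sx xt].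
have [x0 x1] : 0 <= x /\ x <= 1 by lra.
exists (T' *: G (u x) x), K1; split.
- by apply: dvx; rewrite in_itv/= x0 x1.
- by apply: is_derive_eq; rewrite /GRing.scale/= mulr1.
rewrite normrZ; apply: ler_pM => //.
rewrite -[G (u x) x](subrK (G (z x) x)) addrC; apply: le_trans (ler_normD _ _) _.
apply: lerD; first exact: (rf_bound rf).
apply: (@le_trans _ _ (L * `|u x - z x|)).
  by apply: (rf_lip rf) => //; [exact: urho|rewrite subrr normr0].
by apply: ler_wpM2l => //; exact: urho.
Qed.

(** The Gronwall bound around [z] is preserved by a Picard step, so the
    iterates started at [z] never leave the tube. *)
Let picard_admissible u v : admissible u -> picard_rel u v -> admissible v.
Proof.
move=> uadm [vac v0 dv]; split.
  by apply: (lipschitz_of_deriv TB vac _ dv) => *; exact: admissible_tube.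
move=> t t0 t1; have [zac _ dz] := zsol.
pose h t := a * expR ((b + 1) * t).
have hm x y : x <= y -> h x <= h y by move=> xy; rewrite ler_pM2l// ler_expR ler_pM2l.
have ha x : 0 <= x -> a <= h x.
  by move=> /hm; apply: le_trans; rewrite /h mulr0 expR0 mulr1.
suff : `|(v t - z t) - (v 0 - z 0)| <= h t - h 0.
  rewrite v0 subrr subr0 => /le_trans; apply; rewrite lerBlDr lerDl.
  by rewrite (le_trans (ltW a0))// ha.
apply: (@abs_continuous_increment _ _ (fun t => v t - z t)) => //.
- by apply: abs_continuousB; [exact: abs_continuousS vac|exact: abs_continuousS zac].
- by move=> x y _ xy _; exact: hm.
have := ae_and dv dz; apply: ae_mono => s [dvs dzs]; rewrite in_itv/= => /andP[s0 st].
have s01 : s \in `[0, 1] by rewrite in_itv/= s0 (le_trans st).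
have s1 := le_trans st t1.
exists (T *: G (u s) s - Tbar *: G (z s) s), (a * ((b + 1) * expR ((b + 1) * s))); split.
- by apply: is_deriveB; [exact: dvs|exact: dzs].
- exact: is_derive_scaled_expR.
have -> : T *: G (u s) s - Tbar *: G (z s) s =
    (T - Tbar) *: G (z s) s + T *: (G (u s) s - G (z s) s).
  by rewrite scalerBl scalerBr !addrA [RHS](ACl (3*2*(1*4)))/= subrr addr0.
have -> : a * ((b + 1) * expR ((b + 1) * s)) = h s + B * (L * h s).
  by rewrite /h /b; ring.
apply: le_trans (ler_normD _ _) _; rewrite !normrZ; apply: lerD.
  apply: le_trans (ha s s0); apply: le_trans Ta.
  by rewrite ler_wpM2l// (rf_bound rf).
apply: ler_pM => //; apply: le_trans (_ : L * `|u s - z s| <= _).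
  apply: (rf_lip rf) => //; first exact: admissible_tube.
  by rewrite subrr normr0 ltW// (rf_rho rf).
by apply: ler_wpM2l => //; apply uadm.
Qed.

(** The weight exp(2 (b + 1) t) grows at more than twice the Lipschitz constant
    b of the right-hand side, so that one Picard step halves distances. *)
Let picard_contract u1 u2 v1 v2 K : 0 <= K -> admissible u1 -> admissible u2 ->
  picard_rel u1 v1 -> picard_rel u2 v2 ->
  (forall t, 0 <= t -> t <= 1 -> `|u1 t - u2 t| <= K * expR (2 * (b + 1) * t)) ->
  forall t, 0 <= t -> t <= 1 -> `|v1 t - v2 t| <= K / 2 * expR (2 * (b + 1) * t).
Proof.
move=> K0 adm1 adm2 [ac1 v10 d1] [ac2 v20 d2] u12 t t0 t1.
pose h t := K / 2 * expR (2 * (b + 1) * t).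
have K20 : 0 <= K / 2 by rewrite divr_ge0.
have hm x y : x <= y -> h x <= h y.
  by move=> xy; rewrite ler_wpM2l// ler_expR ler_pM2l// mulr_gt0.
suff : `|(v1 t - v2 t) - (v1 0 - v2 0)| <= h t - h 0.
  rewrite v10 v20 subrr subr0 => /le_trans; apply; rewrite lerBlDr lerDl.
  by rewrite mulr_ge0// expR_ge0.
apply: (@abs_continuous_increment _ _ (fun t => v1 t - v2 t)) => //.
- by apply: abs_continuousB; [exact: abs_continuousS ac1|exact: abs_continuousS ac2].
- by move=> x y _ xy _; exact: hm.
have := ae_and d1 d2; apply: ae_mono => s [dvs dzs]; rewrite in_itv/= => /andP[s0 st].
have s01 : s \in `[0, 1] by rewrite in_itv/= s0 (le_trans st).
have s1 := le_trans st t1.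
exists (T *: G (u1 s) s - T *: G (u2 s) s),
  (K / 2 * (2 * (b + 1) * expR (2 * (b + 1) * s))); split.
- by apply: is_deriveB; [exact: dvs|exact: dzs].
- exact: is_derive_scaled_expR.
rewrite -scalerBr normrZ.
have ge0 : 0 <= K * expR (2 * (b + 1) * s) by rewrite mulr_ge0// expR_ge0.
have -> : K / 2 * (2 * (b + 1) * expR (2 * (b + 1) * s)) =
   B * (L * (K * expR (2 * (b + 1) * s))) + K * expR (2 * (b + 1) * s).
  by rewrite /b; field.
apply: ler_wpDr => //; apply: ler_pM => //.
apply: le_trans (_ : L * `|u1 s - u2 s| <= _); last by apply: ler_wpM2l => //; exact: u12.
by apply: (rf_lip rf) => //; exact: admissible_tube.
Qed.

Let picard_step u : admissible u -> exists v, picard_rel u v.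
Proof.
move=> uadm; have [|P [Pac P0 dP]] := rf_prim rf (u := u) (K := K1) uadm.1.
  by move=> *; exact: admissible_tube.
exists (fun t => z 0 + T *: P t); split.
- apply: (@abs_continuous_dom _ _ _ _ _ P P `|T|) => // s t _ _ _.
  have -> : z 0 + T *: P t - (z 0 + T *: P s) = T *: (P t - P s).
    by rewrite scalerBr opprD addrACA subrr add0r.
  by rewrite normrZ ler_wpM2l// lerDl.
- by rewrite P0 scaler0 addr0.
apply: ae_mono dP => t dP t01; apply: is_derive_eq; last exact: add0r.
apply: is_deriveD; apply: is_deriveZ; exact: dP.
Qed.

(** The iterates converge uniformly at a halving rate.  The limit inherits the
    common Lipschitz constant and the bound around [z], so that one more
    Picard step can be applied to it; that step returns the limit itself. *)
Lemma picard_existence : complete_for_halving V ->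
  exists2 u, ode_solution G (z 0) T u &
    forall t, 0 <= t -> t <= 1 -> `|u t - z t| <= rho.
Proof.
move=> cplt.
have [phi phiP] : exists phi, forall u, admissible u -> picard_rel u (phi u).
  have : forall u, exists v, admissible u -> picard_rel u v.
    move=> u; have [/picard_step[v uv]|nadm] := pselect (admissible u); first by exists v.
    by exists u.
  by case/choice => phi phiP; exists phi.
have phi_adm u : admissible u -> admissible (phi u).
  by move=> uadm; apply: picard_admissible (phiP u uadm).
have z_adm : admissible z.
  have [zac _ dz] := zsol; split.
    apply: (@lipschitz_of_deriv Tbar z z) => //; first by rewrite /B lerDl.
    by move=> t _ _; rewrite subrr normr0 ltW// (rf_rho rf).
  by move=> t _ _; rewrite subrr normr0 mulr_ge0 ?expR_ge0// ltW.
pose us i := iter i phi z.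
have us_adm i : admissible (us i) by elim: i => //= i; exact: phi_adm.
pose E t := expR (2 * (b + 1) * t).
have rho0 := ltW (rf_rho rf).
have E1 t : 0 <= t -> 1 <= E t.
  by move=> t0; rewrite -expR0 ler_expR !mulr_ge0// ltW.
have E0 t : 0 <= E t by exact: expR_ge0.
have us_close i m t : 0 <= t -> t <= 1 -> `|us (i + m)%N t - us i t| <= rho * 2^-1 ^+ i * E t.
  elim: i t => [|i IH] t t0 t1.
    rewrite expr0 mulr1 add0n; apply: le_trans (admissible_tube (us_adm m) t0 t1) _.
    by rewrite ler_peMr// E1.
  rewrite exprSr mulrA; apply: (@picard_contract (us (i + m)%N) (us i)) => //.
  - by rewrite mulr_ge0// exprn_ge0.
  - exact: phiP.
  - exact: phiP.
have [lim limP] : exists lim, forall t, 0 <= t -> t <= 1 ->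
    forall i, `|lim t - us i t| <= rho * E 1 * 2^-1 ^+ i.
  have : forall t, exists l, 0 <= t -> t <= 1 -> forall i, `|l - us i t| <= rho * E 1 * 2^-1 ^+ i.
    move=> t; have [/andP[t0 t1]|nt] := boolP (0 <= t <= 1); last first.
      by exists 0 => t0 t1; rewrite t0 t1 in nt.
    have [|l lP] := cplt (fun i => us i t) (rho * E 1); last by exists l.
    move=> i m; apply: le_trans (us_close i m t t0 t1) _.
    by rewrite mulrAC ler_wpM2r ?exprn_ge0// ler_wpM2l// ler_expR ler_wpM2l// mulr_ge0// ltW.
  by case/choice => lim limP; exists lim.
have lim_adm : admissible lim.
  split.
    move=> s t s0 st t1; apply: (@le_halving _ _ _ (rho * E 1 + rho * E 1)) => i.
    have := limP t (le_trans s0 st) t1 i; have := limP s s0 (le_trans st t1) i.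
    have := (us_adm i).1 s t s0 st t1.
    have := ler_distD (us i s) (us i t) (lim s).
    have := ler_distD (us i t) (lim t) (lim s).
    rewrite mulrDl (distrC (us i s) (lim s)); lra.
  move=> t t0 t1; apply: (@le_halving _ _ _ (rho * E 1)) => i.
  have := limP t t0 t1 i; have := (us_adm i).2 t t0 t1.
  have := ler_distD (us i t) (lim t) (z t); lra.
have lim_fix t : 0 <= t -> t <= 1 -> phi lim t = lim t.
  move=> t0 t1; apply/eqP; rewrite -subr_eq0 -normr_eq0; apply/eqP/le_anti.
  rewrite normr_ge0 andbT; apply: (@le_halving _ _ _ (rho * E 1 * E 1 + rho * E 1)) => i.
  rewrite add0r.
  have h1 : `|phi lim t - us i.+1 t| <= rho * E 1 * 2^-1 ^+ i / 2 * E t.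
    apply: (@picard_contract lim (us i)) => //.
    - by rewrite !mulr_ge0// exprn_ge0.
    - exact: phiP.
    - exact: phiP.
    move=> s s0 s1; apply: le_trans (limP s s0 s1 i) _.
    by rewrite ler_peMr ?E1// !mulr_ge0// exprn_ge0.
  have h2 := limP t t0 t1 i.+1.
  have h3 := ler_distD (us i.+1 t) (phi lim t) (lim t).
  rewrite (distrC (us i.+1 t) (lim t)) in h3.
  set c := rho * E 1 in h1 h2 *; set q := 2^-1 ^+ i in h1 *.
  have c0 : 0 <= c by rewrite mulr_ge0// expR_ge0.
  have q0 : 0 <= q by rewrite exprn_ge0.
  have cq : 0 <= c * q by rewrite mulr_ge0.
  have Et : c * q / 2 * E t <= c * q / 2 * E 1.
    by rewrite ler_wpM2l ?divr_ge0// ler_expR ler_wpM2l// mulr_ge0// ltW.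
  have cqE : 0 <= c * q * E 1 by rewrite mulr_ge0// expR_ge0.
  move: h2; rewrite exprSr -/q => h2.
  have -> : (c * E 1 + c) * q = c * q * E 1 + c * q by ring.
  move: h1 h2 h3 Et cqE; lra.
have [lac l0 dl] := phiP lim lim_adm.
exists (phi lim).
  split => //; apply: ae_mono dl => t dlt t01; have := t01.
  by rewrite in_itv/= => /andP[t0 t1]; rewrite lim_fix//; exact: dlt.
by move=> t t0 t1; rewrite lim_fix//; exact: admissible_tube.
Qed.
End picard.

End ode.

(** * Sensitivity with respect to the parameter *)

Lemma abs_continuous_within (R : realType) (V : normedModType R) (g : R -> V) (a b : R) :
  abs_continuous a b g -> {within `[a, b], continuous g}.
Proof.
move=> gac; apply/subspace_continuousP => t /=; rewrite in_itv/= => /andP[at_ tb].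
apply/cvgrPdist_lt => e e0; have [d d0 gd] := abs_continuous_unif gac e0.
exists d => //= s; rewrite /ball_/= ltr_norml => std; rewrite in_itv/= => /andP[as_ sb].
have [st|ts] := leP s t; first by apply: gd => //; lra.
by rewrite distrC; apply: gd => //; lra.
Qed.

Lemma within_bounded (R : realType) (V : normedModType R) (g : R -> V) (a b : R) :
  {within `[a, b], continuous g} -> exists M, forall t, a <= t -> t <= b -> `|g t| <= M.
Proof.
move=> gc; have /compact_bounded[M [_ HM]] := continuous_compact gc (@segment_compact R a b).
exists (M + 1) => t at_ tb; apply: (HM (M + 1)); first by rewrite ltrDl.
by exists t => //=; rewrite in_itv/= at_ tb.
Qed.

Record bounded_pairing (R : realType) (W V : normedModType R) (pr : W -> V -> R) (K : R) : Prop := {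
  pr_ge0 : 0 <= K;
  pr_Bl : forall a b v, pr (a - b) v = pr a v - pr b v;
  pr_Br : forall a v w, pr a (v - w) = pr a v - pr a w;
  pr_Zl : forall c a v, pr (c *: a) v = c * pr a v;
  pr_Zr : forall c a v, pr a (c *: v) = c * pr a v;
  pr_le : forall a v, `|pr a v| <= K * (`|a| * `|v|) }.

Section pairing.
Context (R : realType) (W V : normedModType R) (pr : W -> V -> R) (K : R).
Context (prP : bounded_pairing pr K).

(** The remainder of the product is the sum of the pairings of the remainder of
    [y] with [w s], of [dy] with the increment of [w], and of [y t] with the
    remainder of [w]. *)
Lemma is_derive_pairing (y : R -> W) (w : R -> V) (t : R) dy dw :
  is_derive t 1 y dy -> is_derive t 1 w dw ->
  is_derive t 1 (fun t => pr (y t) (w t)) (pr dy (w t) + pr (y t) dw).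
Proof.
move=> /is_derive_epsP Dy /is_derive_epsP Dw; apply/is_derive_epsP => e e0.
have K0 := pr_ge0 prP.
pose Q := K * (`|w t| + `|dw| + 2 + `|dy| * (`|dw| + 1) + `|y t|) + 1.
have Q0 : 0 < Q.
  by rewrite /Q ltr_wpDl// mulr_ge0// !addr_ge0// mulr_ge0// addr_ge0.
have [e' [e'0 e'1 e'2]] : exists e', [/\ 0 < e', e' <= 1 & e' <= e / Q].
  by exists (Num.min 1 (e / Q)); rewrite lt_min !ge_min !lexx orbT ltr01 divr_gt0.
have [d1 d10 H1] := Dy _ e'0; have [d2 d20 H2] := Dw _ e'0.
exists (Num.min (Num.min d1 d2) e'); first by rewrite !lt_min d10 d20 e'0.
move=> s; rewrite !lt_min => /andP[/andP[s1 s2] s3].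
have h1 := H1 s s1; have h2 := H2 s s2.
set h := `|s - t| in h1 h2 s3 *.
have hge0 : 0 <= h by exact: normr_ge0.
have dwle : `|w s - w t| <= (`|dw| + 1) * h.
  have -> : w s - w t = (w s - w t - (s - t) *: dw) + (s - t) *: dw by rewrite subrK.
  apply: le_trans (ler_normD _ _) _; rewrite normrZ -/h mulrDl mul1r addrC mulrC.
  by rewrite lerD// (le_trans h2)// ler_piMl.
have wsle : `|w s| <= `|w t| + `|dw| + 2.
  rewrite -[w s](subrK (w t)) addrC; apply: le_trans (ler_normD _ _) _.
  rewrite -!addrA lerD2l; apply: le_trans dwle _.
  apply: (@le_trans _ _ (`|dw| + 1)); last lra.
  by rewrite ler_piMr ?addr_ge0//; lra.
have -> : pr (y s) (w s) - pr (y t) (w t) - (s - t) *: (pr dy (w t) + pr (y t) dw) =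
    pr (y s - y t - (s - t) *: dy) (w s) + (s - t) * pr dy (w s - w t) +
    pr (y t) (w s - w t - (s - t) *: dw).
  by rewrite !(pr_Bl prP) !(pr_Br prP) (pr_Zl prP) (pr_Zr prP) /GRing.scale/=; ring.
have t1 : `|pr (y s - y t - (s - t) *: dy) (w s)| <= e' * h * (K * (`|w t| + `|dw| + 2)).
  apply: le_trans (pr_le prP _ _) _; rewrite mulrCA ler_pM// ?mulr_ge0//.
  by rewrite ler_wpM2l.
have t2 : `|(s - t) * pr dy (w s - w t)| <= e' * h * (K * (`|dy| * (`|dw| + 1))).
  rewrite normrM -/h.
  apply: (@le_trans _ _ (h * (K * (`|dy| * ((`|dw| + 1) * e'))))); last first.
    by lra.
  apply: ler_wpM2l => //; apply: le_trans (pr_le prP _ _) _.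
  do 2 (apply: ler_wpM2l => //); apply: le_trans dwle _.
  by rewrite ler_wpM2l ?addr_ge0// ltW.
have t3 : `|pr (y t) (w s - w t - (s - t) *: dw)| <= e' * h * (K * `|y t|).
  apply: le_trans (pr_le prP _ _) _.
  by rewrite mulrA mulrC ler_wpM2r// mulr_ge0.
have : e' * h * Q <= e * h.
  rewrite mulrAC ler_wpM2r//.
  by rewrite -[leRHS](divfK (lt0r_neq0 Q0)) ler_wpM2r// ltW.
apply: le_trans; apply: le_trans (ler_normD _ _) _.
apply: le_trans (lerD (ler_normD _ _) (lexx _)) _.
apply: le_trans (lerD (lerD t1 t2) t3) _.
rewrite -!mulrDr ler_wpM2l// ?mulr_ge0// ?(ltW e'0)// /Q; lra.
Qed.

Lemma abs_continuous_pairing (y : R -> W) (w : R -> V) a b :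
  abs_continuous a b y -> abs_continuous a b w ->
  abs_continuous a b (fun t => pr (y t) (w t)).
Proof.
move=> yac wac; have K0 := pr_ge0 prP.
have [Y HY] := within_bounded (abs_continuous_within yac).
have [Z HZ] := within_bounded (abs_continuous_within wac).
apply: (@abs_continuous_dom _ _ _ _ _ y w (K * (`|Y| + `|Z|))) => // s t as_ st tb.
have -> : pr (y t) (w t) - pr (y s) (w s) = pr (y t - y s) (w t) + pr (y s) (w t - w s).
  by rewrite (pr_Bl prP) (pr_Br prP); ring.
apply: le_trans (ler_normD _ _) _.
apply: le_trans (lerD (pr_le prP _ _) (pr_le prP _ _)) _.
rewrite -mulrDr -mulrA ler_wpM2l//.
have h1 : `|w t| <= `|Z| by apply: le_trans (ler_norm _); apply: HZ; lra.
have h2 : `|y s| <= `|Y| by apply: le_trans (ler_norm _); apply: HY; lra.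
have h3 : `|y t - y s| * `|w t| <= `|y t - y s| * `|Z| by rewrite ler_wpM2l.
have h4 : `|y s| * `|w t - w s| <= `|Y| * `|w t - w s| by rewrite ler_wpM2r.
have h5 : 0 <= `|Y| * `|y t - y s| by rewrite mulr_ge0.
have h6 : 0 <= `|Z| * `|w t - w s| by rewrite mulr_ge0.
rewrite mulrDl !mulrDr; lra.
Qed.
End pairing.

Section sensitivity.
Context (R : realType) (V : normedModType R) (G : V -> R -> V) (z : R -> V)
  (A : R -> {linear V -> V}) (rho L M Tbar : R).
Context (rf : regular_field G z A rho L M).
Context (zsol : ode_solution G (z 0) Tbar z).

(** For these parameters the deviation bound keeps solutions in the tube. *)
Definition close_param (T : R) : Prop :=
  `|T| <= `|Tbar| + 1 /\ `|T - Tbar| * (M + 1) * gronwall_factor L Tbar <= rho.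

Let C := second_order_constant L M Tbar.

Lemma near_close_param : \forall T \near Tbar, close_param T.
Proof.
have k0 : 0 < (M + 1) * gronwall_factor L Tbar.
  by rewrite mulr_gt0 ?expR_gt0// ltr_wpDl// (rf_M rf).
have d0 : 0 < Num.min 1 (rho / ((M + 1) * gronwall_factor L Tbar)).
  by rewrite lt_min ltr01 divr_gt0// (rf_rho rf).
apply/nbhs_ballP; exists (Num.min 1 (rho / ((M + 1) * gronwall_factor L Tbar))) => //= T.
rewrite /ball/= distrC lt_min => /andP[T1 T2]; split.
  have := ler_normD (T - Tbar) Tbar; rewrite subrK; lra.
by rewrite -mulrA -ler_pdivlMr// ltW.
Qed.

Let C0 : 0 <= C.
Proof.
have := rf_M rf; have := rf_L rf; move=> L0 M0.
by rewrite /C /second_order_constant addr_ge0// ?mulr_ge0 ?exprn_ge0 ?mulr_ge0 ?addr_ge0 ?expR_ge0.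
Qed.

(** Both quotients q satisfy q' = G(z) + Tbar A q up to errors bounded by a
    multiple of |T - Tbar|; the difference of the quotients therefore satisfies
    the homogeneous linear equation up to such errors, and Gronwall applies. *)
Lemma difference_quotient_cauchy T1 T2 u1 u2 :
  close_param T1 -> close_param T2 -> T1 != Tbar -> T2 != Tbar ->
  ode_solution G (z 0) T1 u1 -> ode_solution G (z 0) T2 u2 ->
  `|(T1 - Tbar)^-1 *: (u1 1 - z 1) - (T2 - Tbar)^-1 *: (u2 1 - z 1)| <=
    (C + 1) * (`|T1 - Tbar| + `|T2 - Tbar|) * gronwall_factor L Tbar.
Proof.
move=> [T1B T1r] [T2B T2r] T1T T2T sol1 sol2.
have lin1 := solution_linearization rf zsol T1B T1r T1T sol1.
have lin2 := solution_linearization rf zsol T2B T2r T2T sol2.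
have [ac1 u10 _] := sol1; have [ac2 u20 _] := sol2; have [zac _ _] := zsol.
have L0 := rf_L rf.
set th1 := T1 - Tbar in lin1 T1T *; set th2 := T2 - Tbar in lin2 T2T *.
have th10 : th1 != 0 by rewrite subr_eq0.
have th20 : th2 != 0 by rewrite subr_eq0.
pose q1 t := th1^-1 *: (u1 t - z t); pose q2 t := th2^-1 *: (u2 t - z t).
have qac (th : R) u : abs_continuous 0 1 u -> abs_continuous 0 1 (fun t => th *: (u t - z t)).
  move=> uac; apply: (@abs_continuous_dom _ _ _ _ _ (fun t => u t - z t) z `|th|) => //.
    exact: abs_continuousB.
  by move=> s t _ _ _; rewrite -scalerBr normrZ ler_wpM2l// lerDl.
have -> : gronwall_factor L Tbar = expR (((`|Tbar| + 1) * L + 1) * 1) by rewrite mulr1.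
apply: (@gronwall _ _ (fun t => q1 t - q2 t)) => //.
- by apply: mulr_gt0; [exact: ltr_wpDl|rewrite ltr_wpDl// normr_gt0].
- by rewrite mulr_ge0// addr_ge0.
- by apply: abs_continuousB; exact: qac.
- by rewrite /q1 /q2 u10 u20 !subrr !scaler0 subrr.
have := ae_and lin1 lin2; apply: ae_mono => t [l1 l2] t01 _.
have := t01; rewrite in_itv/= => /andP[t0 t1].
have [dw1 d1 e1] := l1 t01; have [dw2 d2 e2] := l2 t01.
exists (th1^-1 *: dw1 - th2^-1 *: dw2).
  by apply: is_deriveB; apply: is_deriveZ.
have err (th : R) dw w : th != 0 ->
    `|dw - th *: G (z t) t - Tbar *: A t w| <= C * `|th| ^+ 2 ->
    `|th^-1 *: dw - G (z t) t - Tbar *: A t (th^-1 *: w)| <= C * `|th|.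
  move=> th0; have -> : th^-1 *: dw - G (z t) t - Tbar *: A t (th^-1 *: w) =
      th^-1 *: (dw - th *: G (z t) t - Tbar *: A t w).
    by rewrite [A t (_ *: _)]linearZ/= !scalerBr !scalerA mulVf// scale1r [Tbar * _]mulrC.
  by rewrite normrZ normfV ler_pdivrMl ?normr_gt0// => /le_trans; apply; lra.
have {}e1 := err _ _ _ th10 e1; have {}e2 := err _ _ _ th20 e2.
rewrite -/(q1 t) in e1; rewrite -/(q2 t) in e2.
set E1 := (X in `|X| <= _) in e1; set E2 := (X in `|X| <= _) in e2.
have -> : th1^-1 *: dw1 - th2^-1 *: dw2 = (E1 - E2) + Tbar *: A t (q1 t - q2 t).
  rewrite [A t (_ - _)]linearB/= scalerBr /E1 /E2.
  set a := th1^-1 *: dw1; set c := th2^-1 *: dw2; set g := G _ _.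
  set p := Tbar *: _; set q := Tbar *: _.
  rewrite !opprB !addrA.
  by rewrite [RHS](ACl (1*6*(2*5)*(3*7)*(4*8)))/= !addNr !subrr !addr0.
apply: le_trans (ler_normD _ _) _; apply: lerD.
  apply: le_trans (ler_normB _ _) _; apply: le_trans (lerD e1 e2) _.
  by rewrite -mulrDr ler_wpM2r ?addr_ge0// lerDl.
rewrite normrZ -mulrA; apply: ler_pM => //; first by rewrite lerDl.
exact: (rf_lin rf).
Qed.

(** By the equation of [y] the terms with [A] cancel in the derivative of the
    pairing of [y] with the deviation, which leaves T - Tbar times the
    derivative of [Phi] and a quadratic error. *)
Lemma adjoint_pairing_estimate (W : normedModType R) (pr : W -> V -> R) (K : R)
    (y : R -> W) (Phi : R -> R) : bounded_pairing pr K ->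
  abs_continuous 0 1 y ->
  {ae (@lebesgue_measure R), forall t : R, t \in `[0, 1] ->
     exists2 dy, is_derive t 1 y dy & forall v, pr dy v = - Tbar * pr (y t) (A t v)} ->
  abs_continuous 0 1 Phi -> Phi 0 = 0 ->
  {ae (@lebesgue_measure R), forall t : R, t \in `[0, 1] ->
     is_derive t 1 Phi (pr (y t) (G (z t) t))} ->
  exists Q, forall T u, close_param T -> T != Tbar -> ode_solution G (z 0) T u ->
    `|pr (y 1) (u 1 - z 1) - (T - Tbar) * Phi 1| <= Q * `|T - Tbar| ^+ 2.
Proof.
move=> prP yac dy Phiac Phi0 dPhi.
have [Y HY] := within_bounded (abs_continuous_within yac).
exists (K * (`|Y| * C)) => T u [TB Tr] TT sol.
have lin := solution_linearization rf zsol TB Tr TT sol.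
have [uac u0 _] := sol; have [zac _ _] := zsol.
pose P t := pr (y t) (u t - z t) - (T - Tbar) * Phi t.
pose q := K * (`|Y| * C) * `|T - Tbar| ^+ 2.
have K0 := pr_ge0 prP.
have q0 : 0 <= q by rewrite !mulr_ge0.
suff : `|P 1 - P 0| <= q * 1 - q * 0.
  have pr0 v : pr v 0 = 0 by rewrite -[X in pr _ X](subrr 0) (pr_Br prP) subrr.
  by rewrite mulr0 subr0 mulr1 /P Phi0 u0 subrr pr0 mulr0 subrr subr0.
apply: (@abs_continuous_increment _ _ P ( *%R q)) => //.
- apply: abs_continuousB; first by apply: (abs_continuous_pairing prP) => //; exact: abs_continuousB.
  apply: (@abs_continuous_dom _ _ _ _ _ Phi Phi `|T - Tbar|) => // s t _ _ _.
  by rewrite -mulrBr normrM ler_wpM2l// lerDl.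
- by move=> s t _ st _; apply: ler_wpM2l.
have := ae_and (ae_and dy dPhi) lin; apply: ae_mono => t [[dyt dPt] lt] t01.
have := t01; rewrite in_itv/= => /andP[t0 t1].
have [y' dy' y'A] := dyt t01; have [w' dw' w'E] := lt t01.
exists (pr y' (u t - z t) + pr (y t) w' - (T - Tbar) *: pr (y t) (G (z t) t)), q; split.
- apply: is_deriveB; first exact: (is_derive_pairing prP dy' dw').
  by apply: is_deriveZ; exact: dPt.
- by apply: is_derive_eq; rewrite /GRing.scale/= mulr1.
have -> : pr y' (u t - z t) + pr (y t) w' - (T - Tbar) *: pr (y t) (G (z t) t) =
    pr (y t) (w' - (T - Tbar) *: G (z t) t - Tbar *: A t (u t - z t)).
  by rewrite y'A !(pr_Br prP) !(pr_Zr prP) /GRing.scale/=; ring.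
apply: le_trans (pr_le prP _ _) _; rewrite /q -mulrA ler_wpM2l//.
rewrite -mulrA; apply: ler_pM => //.
by apply: le_trans (ler_norm _); exact: HY.
Qed.
End sensitivity.

(** * Primitives of bounded functions with finitely many discontinuities *)

Lemma integrable_off_finite (R : realType) (g : R -> R) (S : set R) (M : R) :
  finite_set S -> (forall t, 0 <= t -> t <= 1 -> `|g t| <= M) ->
  (forall t, 0 < t -> t < 1 -> ~ S t -> {for t, continuous g}) ->
  (@lebesgue_measure R).-integrable `[0, 1] (EFin \o g).
Proof.
move=> finS gM gc.
pose S' := S `|` [set 0; 1].
have finS' : finite_set S' by rewrite finite_setU; split.
have cS' : closed S'.
  by apply: (accessible_finite_set_closed.1 _ _ finS'); exact: (hausdorff_accessible (@Rhausdorff R)).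
pose D := `]0, 1[ `&` ~` S'.
have oD : open D by apply: openI; [exact: interval_open|exact: closed_openC].
have fin_meas (B : set R) : finite_set B -> measurable B.
  by move=> finB; apply: countable_measurable => //; exact: finite_set_countable.
apply: measurable_bounded_integrable => //.
- by rewrite /= lebesgue_measure_itv/= lte_fin ltr01 ltry.
- have -> : `[0, 1]%classic = D `|` (`[0, 1] `&` S').
    apply/seteqP; split => t /=.
      rewrite in_itv/= => /andP[t0 t1]; have [tS|tS] := pselect (S' t); [right|left].
        by rewrite t0 t1.
      split => //; rewrite /= in_itv/= !lt_neqAle t0 t1 !andbT.
      by apply/andP; split; apply/eqP => te; apply: tS; right; [left|right].
    by rewrite !in_itv/= => -[[/andP[t0 t1] _]|[]//]; rewrite !ltW.
  have mB : measurable (`[0, 1] `&` S') by apply: measurableI => //; exact: fin_meas.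
  apply/measurable_funU => //; first exact: measurable_realfun.open_measurable.
  split.
    apply: open_continuous_measurable_fun => // t; rewrite inE /D/= in_itv/= => -[/andP[t0 t1] tS].
    by apply: gc => // St; apply: tS; left.
  move=> _ Y mY; apply: fin_meas; apply: sub_finite_set finS'.
  by move=> t [[_ ?] _].
exists M; split; first exact: num_real.
move=> x Mx t /=; rewrite in_itv/= => /andP[t0 t1].
by apply: le_trans (ltW Mx); exact: gM.
Qed.

Lemma primitive_off_finite (R : realType) (g : R -> R) (S : set R) (M : R) :
  finite_set S -> (forall t, 0 <= t -> t <= 1 -> `|g t| <= M) ->
  (forall t, 0 < t -> t < 1 -> ~ S t -> {for t, continuous g}) ->
  let Phi t := \int[@lebesgue_measure R]_(tau in `[0, t]) g tau in
  [/\ forall s t, 0 <= s -> s <= t -> t <= 1 -> `|Phi t - Phi s| <= M * (t - s),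
    Phi 0 = 0 &
    forall t, 0 < t -> t < 1 -> ~ S t -> is_derive t 1 Phi (g t)].
Proof.
move=> finS gM gc Phi.
have gint := integrable_off_finite finS gM gc.
split.
- move=> s t s0 st t1.
  have itv0 (v : R) : v <= 1 -> (@lebesgue_measure R).-integrable `[0, v] (EFin \o g).
    move=> v1; apply: integrableS gint => //.
    by apply: subset_itvl; rewrite bnd_simp.
  rewrite /Phi Rintegral_itvB//; last first.
  - exact: itv0.
  have ist : (@lebesgue_measure R).-integrable `]s, t] (EFin \o g).
    apply: integrableS gint => //; apply: subset_itv; rewrite bnd_simp//.
  apply: le_trans (le_normr_Rintegral _ _) _ => //.
  have M_int : (@lebesgue_measure R).-integrable `]s, t] (EFin \o (fun=> M)).
    apply/measurable_bounded_integrable => //.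
      by rewrite /= lebesgue_measure_itv/=; case: ifPn => _; rewrite ?ltry.
    by exists `|M|; split; [exact: num_real|move=> x Mx y _; exact: ltW].
  apply: (@le_trans _ _ (\int[@lebesgue_measure R]_(x in `]s, t]) M)).
    apply: le_Rintegral => //; first exact: integrable_norm ist.
    by move=> x /=; rewrite in_itv/= => /andP[sx xt]; apply: gM; lra.
  rewrite Rintegral_cst//= lebesgue_measure_itv/= lte_fin.
  by case: ltP => //= ts; have -> : s = t by [lra]; rewrite subrr.
- by rewrite /Phi set_itv1 Rintegral_set1.
move=> t t0 t1 St.
have [d e] := @continuous_FTC1_closed _ g 0 t 1 t1 gint t0 (gc t t0 t1 St).
by rewrite -e derive1E; exact: derivableP.
Qed.

(** * Norm estimates on states *)

Lemma mx_entry_le (R : realType) m n (M : 'M[R]_(m, n)) i j : `|M i j| <= `|M|.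
Proof. by rewrite [leRHS]/Num.Def.normr/= mx_normrE; exact: (le_bigmax _ _ (i, j)). Qed.

Lemma mx_norm_le (R : realType) m n (M : 'M[R]_(m, n)) c : 0 <= c ->
  (forall i j, `|M i j| <= c) -> `|M| <= c.
Proof.
by move=> c0 H; rewrite [leLHS]/Num.Def.normr/= mx_normrE bigmax_le// => -[i j] _; exact: H.
Qed.

Lemma mulmx_norm_le (R : realType) m n q (M : 'M[R]_(m, n)) (N : 'M[R]_(n, q)) :
  `|M *m N| <= n%:R * (`|M| * `|N|).
Proof.
apply: mx_norm_le => [|i j]; first by rewrite !mulr_ge0.
rewrite mxE; apply: le_trans (ler_norm_sum _ _ _) _.
apply: le_trans (_ : \sum_(l < n) `|M| * `|N| <= _); last by rewrite sumr_const card_ord mulr_natl.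
by apply: ler_sum => l _; rewrite normrM ler_pM// mx_entry_le.
Qed.

Definition pack_linear (R : realType) (V W : normedModType R) (g : V -> W) (gl : linear g) :
  {linear V -> W} := HB.pack g (GRing.isLinear.Build R V W *:%R g gl).

Lemma fst_norm_le (R : realType) (V W : normedModType R) (v : V * W) : `|v.1| <= `|v|.
Proof. by rewrite prod_normE le_max lexx. Qed.

Lemma snd_norm_le (R : realType) (V W : normedModType R) (v : V * W) : `|v.2| <= `|v|.
Proof. by rewrite prod_normE le_max lexx orbT. Qed.

Lemma pair_norm_le (R : realType) (V W : normedModType R) (v : V * W) c :
  `|v.1| <= c -> `|v.2| <= c -> `|v| <= c.
Proof. by rewrite prod_normE ge_max => -> ->. Qed.

Lemma state_basis (R : realType) n (v : 'cV[R]_n * 'rV[R]_n) :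
  v = \sum_i v.1 i 0 *: ((delta_mx i 0, 0) : 'cV[R]_n * 'rV[R]_n) +
      \sum_j v.2 0 j *: ((0, delta_mx 0 j) : 'cV[R]_n * 'rV[R]_n).
Proof.
have fstE I (F : I -> 'cV[R]_n * 'rV[R]_n) r : (\sum_(i <- r) F i).1 = \sum_(i <- r) (F i).1.
  by apply: (big_morph fst).
have sndE I (F : I -> 'cV[R]_n * 'rV[R]_n) r : (\sum_(i <- r) F i).2 = \sum_(i <- r) (F i).2.
  by apply: (big_morph snd).
rewrite [LHS]surjective_pairing [RHS]surjective_pairing /=; congr (_, _).
  rewrite fstE [X in _ + X]fstE [X in _ + X]big1 ?addr0; last first.
    by move=> i _; rewrite /= scaler0.
  rewrite [LHS]matrix_sum_delta; apply: eq_bigr => i _; by rewrite big_ord1.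
rewrite sndE [X in _ + X]sndE [X in X + _]big1 ?add0r; last first.
  by move=> i _; rewrite /= scaler0.
by rewrite [LHS]matrix_sum_delta big_ord1.
Qed.

(** Bounds the operator norm through the values on the canonical basis, so that
    a bound along a curve follows from continuity in each direction. *)
Definition state_op_bound (R : realType) n (W : normedModType R)
    (D : {linear (('cV[R]_n * 'rV[R]_n) * R)%type -> W}) : R :=
  \sum_i `|D ((delta_mx i 0, 0), 0)| + \sum_j `|D ((0, delta_mx 0 j), 0)| + `|D (0, 1)|.

Lemma state_op_bound_ge0 (R : realType) n (W : normedModType R)
    (D : {linear (('cV[R]_n * 'rV[R]_n) * R)%type -> W}) : 0 <= state_op_bound D.
Proof. by rewrite !addr_ge0// sumr_ge0. Qed.

Lemma state_op_boundP (R : realType) n (W : normedModType R)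
    (D : {linear (('cV[R]_n * 'rV[R]_n) * R)%type -> W}) v :
  `|D v| <= state_op_bound D * `|v|.
Proof.
case: v => h c; set N := `|(h, c)|.
have hN : `|h| <= N by exact: (fst_norm_le (h, c)).
have cN : `|c| <= N by exact: (snd_norm_le (h, c)).
have vE : (h, c) = \sum_i h.1 i 0 *: (((delta_mx i 0, 0), 0) : ('cV[R]_n * 'rV[R]_n) * R) +
  \sum_j h.2 0 j *: (((0, delta_mx 0 j), 0) : ('cV[R]_n * 'rV[R]_n) * R) +
  c *: ((0, 1) : ('cV[R]_n * 'rV[R]_n) * R).
  have inE I (F : I -> 'cV[R]_n * 'rV[R]_n) r :
      ((\sum_(i <- r) F i, 0) : ('cV[R]_n * 'rV[R]_n) * R) = \sum_(i <- r) (F i, 0).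
    apply: (big_morph (fun x => (x, 0) : ('cV[R]_n * 'rV[R]_n) * R)) => //.
    by move=> x y; congr (_, _); rewrite addr0.
  have scE (a : R) (w : 'cV[R]_n * 'rV[R]_n) :
      a *: ((w, 0) : ('cV[R]_n * 'rV[R]_n) * R) = (a *: w, 0).
    by congr (_, _); exact: mulr0.
  under eq_bigr do rewrite scE.
  under [X in _ + X + _]eq_bigr do rewrite scE.
  rewrite -!inE; congr (_, _) => /=; first by rewrite scaler0 addr0 -state_basis.
  by rewrite !add0r; symmetry; exact: mulr1.
rewrite vE !linearD !linear_sum linearZ/=.
have hle i : `|h.1 i 0| <= N.
  by apply: le_trans (mx_entry_le _ _ _) _; apply: le_trans (fst_norm_le _) hN.
have hle2 j : `|h.2 0 j| <= N.
  by apply: le_trans (mx_entry_le _ _ _) _; apply: le_trans (snd_norm_le _) hN.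
apply: le_trans (ler_normD _ _) _; rewrite /state_op_bound mulrDl; apply: lerD.
  apply: le_trans (ler_normD _ _) _; rewrite mulrDl; apply: lerD.
    apply: le_trans (ler_norm_sum _ _ _) _; rewrite mulr_suml; apply: ler_sum => i _.
    by rewrite linearZ/= normrZ mulrC ler_wpM2l.
  apply: le_trans (ler_norm_sum _ _ _) _; rewrite mulr_suml; apply: ler_sum => i _.
  by rewrite linearZ/= normrZ mulrC ler_wpM2l.
by rewrite normrZ mulrC ler_wpM2l.
Qed.

Lemma derivative_on_eps (R : realType) (V W : normedModType R) (A : set V)
    (g : V -> W) (D : V -> {linear V -> W}) : derivative_on A g D ->
  forall v, A v -> forall e, 0 < e -> exists2 d, 0 < d & forall v', A v' ->
    `|v' - v| < d -> `|g v' - g v - D v (v' - v)| <= e * `|v' - v|.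
Proof.
move=> gD v Av e e0; have /eqoP/(_ _ e0) := gD v Av.
move=> /nbhs_ballP[d /= d0 dP]; exists d => // v' Av' v'd.
by apply: (dP v') => //; rewrite -ball_normE /ball_/= distrC.
Qed.

Lemma derivative_on_within (R : realType) n (W : normedModType R)
    (A : set (('cV[R]_n * 'rV[R]_n) * R)) (g : ('cV[R]_n * 'rV[R]_n) * R -> W)
    (D : ('cV[R]_n * 'rV[R]_n) * R -> {linear (('cV[R]_n * 'rV[R]_n) * R)%type -> W}) :
  derivative_on A g D -> {within A, continuous g}.
Proof.
move=> gD; apply/subspace_continuousP => v Av; apply/cvgrPdist_lt => e e0.
have [d d0 dP] := derivative_on_eps gD Av ltr01.
pose B := state_op_bound (D v) + 1.
have B0 : 0 < B by rewrite ltr_wpDl// state_op_bound_ge0.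
apply/nbhs_ballP; exists (Num.min d (e / B)); first by rewrite /= lt_min d0 divr_gt0.
move=> v'; rewrite -ball_normE /ball_/= distrC lt_min => /andP[v'd v'e] Av'.
have := dP v' Av' v'd; rewrite mul1r => h1; have h2 := state_op_boundP (D v) (v' - v).
rewrite distrC -[g v' - g v](subrK (D v (v' - v))).
apply: le_lt_trans (ler_normD _ _) _; apply: le_lt_trans (lerD h1 h2) _.
have -> : `|v' - v| + state_op_bound (D v) * `|v' - v| = `|v' - v| * B by rewrite /B; ring.
by rewrite -ltr_pdivlMr.
Qed.

Lemma within_comp (R : realType) (X Y : topologicalType) (A : set X) (B : set R)
    (g : X -> Y) (c : R -> X) :
  {within A, continuous g} -> {within B, continuous c} -> (forall t, B t -> A (c t)) ->
  {within B, continuous (fun t => g (c t))}.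
Proof.
move=> /subspace_continuousP gc /subspace_continuousP cc BA.
apply/subspace_continuousP => t Bt.
apply: (@cvg_comp _ _ _ c g _ (within A (nbhs (c t)))); last exact: gc (BA _ Bt).
move=> U AU; have := cc t Bt _ AU.
apply: (@filterS _ (nbhs t) _ (fun s => B s -> A (c s) -> U (c s)) (fun s => B s -> U (c s))).
by move=> s H Bs; apply: H => //; exact: BA.
Qed.

(** The function g(p(sg)) - sg D(c), where p runs along the segment, has
    derivative D(p(sg)) - D(c) in the direction c2 - c1.  The segment lies in
    [A], so differentiability relative to [A] gives this derivative.  The choice c = c1
    gives a Taylor remainder; the choice of the center of a ball for c gives a
    Lipschitz bound on the ball. *)
Lemma segment_taylor (R : realType) n (W : normedModType R)
    (A : set (('cV[R]_n * 'rV[R]_n) * R)) (g : ('cV[R]_n * 'rV[R]_n) * R -> W)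
    (D : ('cV[R]_n * 'rV[R]_n) * R -> {linear (('cV[R]_n * 'rV[R]_n) * R)%type -> W})
    (L r t : R) (c c1 c2 : 'cV[R]_n * 'rV[R]_n) :
  derivative_on A g D -> 0 <= L ->
  (forall chi chi' h, A (chi, t) -> A (chi', t) ->
     `|D (chi, t) (h, 0) - D (chi', t) (h, 0)| <= L * `|chi - chi'| * `|h|) ->
  A (c, t) ->
  (forall sg, 0 <= sg -> sg <= 1 ->
     A (c1 + sg *: (c2 - c1), t) /\ `|c1 + sg *: (c2 - c1) - c| <= r) ->
  `|g (c2, t) - g (c1, t) - D (c, t) (c2 - c1, 0)| <= L * r * `|c2 - c1|.
Proof.
move=> gD L0 DL Ac seg; set h := c2 - c1 in seg *.
pose p sg := (c1 + sg *: h, t); pose phi sg := g (p sg) - sg *: D (c, t) (h, 0).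
have -> : g (c2, t) - g (c1, t) - D (c, t) (h, 0) = phi 1 - phi 0.
  by rewrite /phi /p !scale1r !scale0r subr0 addr0 [c1 + _]addrC subrK addrAC.
apply/ler_addgt0Pr => e e0.
have -> : L * r * `|h| + e = (L * r * `|h| + e) * 1 - (L * r * `|h| + e) * 0.
  by rewrite mulr1 mulr0 subr0.
apply: (@local_increment _ _ phi ( *%R (L * r * `|h| + e))) => // sg s0 s1.
have [As rs] := seg sg s0 s1.
have h10 : 0 < `|h| + 1 by rewrite ltr_wpDl.
have e'0 : 0 < e / (`|h| + 1) by rewrite divr_gt0.
have [d d0 dP] := derivative_on_eps gD As e'0.
exists (d / (`|h| + 1)); first by rewrite divr_gt0.
move=> u v u0 us sv v1 uv.
have psub a b : p a - p b = ((a - b) *: h, 0).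
  by rewrite /p; congr (_, _); [rewrite /= opprD addrACA subrr add0r scalerBl|rewrite /= subrr].
have inc a : 0 <= a -> a <= 1 -> `|a - sg| <= v - u ->
    `|g (p a) - g (p sg) - (a - sg) *: D (p sg) (h, 0)| <= e / (`|h| + 1) * (`|a - sg| * `|h|).
  move=> a0 a1 asg.
  have Dp : (a - sg) *: D (p sg) (h, 0) = D (p sg) (p a - p sg).
    rewrite -linearZ psub; congr (D _ _); congr (_, _); exact: mulr0.
  have np : `|p a - p sg| = `|a - sg| * `|h|.
    by rewrite psub prod_normE/= normr0 normrZ max_l// mulr_ge0.
  rewrite Dp -np; apply: dP; first by have [] := seg a a0 a1.
  rewrite -/(p sg) np; apply: (@le_lt_trans _ _ ((v - u) * (`|h| + 1))).
    by apply: ler_pM => //; rewrite lerDl.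
  by rewrite -ltr_pdivlMr.
have ev : `|v - sg| = v - sg by rewrite ger0_norm //; lra.
have eu : `|u - sg| = sg - u by rewrite ler0_norm; lra.
have hv := inc v ltac:(lra) v1 ltac:(rewrite ev; lra).
have hu := inc u u0 ltac:(lra) ltac:(rewrite eu; lra).
rewrite ev in hv; rewrite eu in hu.
set k := D (p sg) (h, 0) in hv hu.
have kD : `|k - D (c, t) (h, 0)| <= L * r * `|h|.
  apply: le_trans (DL _ _ _ As Ac) _.
  by rewrite ler_wpM2r// ler_wpM2l.
have -> : phi v - phi u = (g (p v) - g (p sg) - (v - sg) *: k) -
    (g (p u) - g (p sg) - (u - sg) *: k) + (v - u) *: (k - D (c, t) (h, 0)).
  rewrite /phi; set q := D (c, t) _.
  have -> : (v - u) *: (k - q) = (v - sg) *: k - (u - sg) *: k - (v *: q - u *: q).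
    by rewrite -!scalerBl opprB addrA subrK -scalerBr.
  rewrite !opprD !opprK !addrA.
  rewrite [LHS](ACl (1*3*2*4))/= [RHS](ACl (1*4*9*10*(2*5)*(3*7)*(6*8)))/=.
  by rewrite !addNr subrr !addr0.
apply: le_trans (ler_normD _ _) _.
apply: le_trans (lerD (ler_normB _ _) (lexx _)) _.
rewrite normrZ (ger0_norm (_ : 0 <= v - u)); last lra.
apply: le_trans (lerD (lerD hv hu) (lexx _)) _.
have : (v - u) * `|k - D (c, t) (h, 0)| <= (v - u) * (L * r * `|h|) by apply: ler_wpM2l => //; lra.
have : e / (`|h| + 1) * ((v - u) * `|h|) <= (v - u) * e.
  rewrite mulrCA ler_wpM2l ?subr_ge0 ?(le_trans us)//.
  by rewrite mulrAC ler_pdivrMr// ler_wpM2l ?(ltW e0)// lerDl.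
lra.
Qed.

(** * The costate part of the field and the stages *)

Section costate.
Context (R : realType) (n : nat).
Implicit Types (p : 'rV[R]_n) (w d : 'cV[R]_n * 'M[R]_n).

(** The coupled field as a function of the costate and of the data
    w = (f_j, f_jx), to which the regularity assumption applies. *)
Definition costate_field p w : 'cV[R]_n * 'rV[R]_n := (w.1, - (p *m w.2)).

(** The differential of [costate_field] at (p, w) in the direction (q, d). *)
Definition costate_field_diff p w (q : 'rV[R]_n) d : 'cV[R]_n * 'rV[R]_n :=
  (d.1, - (q *m w.2 + p *m d.2)).

Lemma costate_field_dist p p' w w' :
  `|costate_field p' w' - costate_field p w| <=
    (1 + n%:R * `|p'|) * `|w' - w| + n%:R * `|w| * `|p' - p|.
Proof.
have n0 : 0 <= n%:R :> R by [].
apply: pair_norm_le => /=.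
  apply: le_trans (fst_norm_le (w' - w)) _.
  by rewrite mulrDl mul1r -addrA lerDl addr_ge0// !mulr_ge0.
have -> : - (p' *m w'.2) - - (p *m w.2) = - (p' *m (w' - w).2 + (p' - p) *m w.2).
  by rewrite /= mulmxBr mulmxBl addrA subrK opprB opprK addrC.
rewrite normrN; apply: le_trans (ler_normD _ _) _; apply: lerD.
  apply: le_trans (mulmx_norm_le _ _) _; rewrite mulrA.
  by apply: ler_pM; rewrite ?mulr_ge0// ?lerDr//; exact: snd_norm_le.
apply: le_trans (mulmx_norm_le _ _) _; rewrite -!mulrA ler_wpM2l// mulrC ler_wpM2r//.
exact: snd_norm_le.
Qed.

(** The quadratic part of the product p w_2 is the product of the increments. *)
Lemma costate_field_taylor p p' w w' d :
  `|costate_field p' w' - costate_field p w - costate_field_diff p w (p' - p) d| <=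
    (1 + n%:R * `|p|) * `|w' - w - d| + n%:R * (`|p' - p| * `|w' - w|).
Proof.
have n0 : 0 <= n%:R :> R by [].
apply: pair_norm_le => /=.
  apply: le_trans (fst_norm_le (w' - w - d)) _.
  by rewrite mulrDl mul1r -[leRHS]addrA lerDl addr_ge0// !mulr_ge0.
have -> : - (p' *m w'.2) - - (p *m w.2) - - ((p' - p) *m w.2 + p *m d.2) =
    - (p *m (w' - w - d).2 + (p' - p) *m (w' - w).2).
  rewrite /= !mulmxBr !mulmxBl !opprK !opprD !opprK !addrA.
  rewrite [LHS](ACl (1*3*5*(2*4)))/= [RHS](ACl (4*6*3*(1*5)*(2*7)))/=.
  by rewrite addNr !subrr !addr0.
rewrite normrN; apply: le_trans (ler_normD _ _) _; apply: lerD.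
  apply: le_trans (mulmx_norm_le _ _) _; rewrite mulrA.
  by apply: ler_pM; rewrite ?mulr_ge0// ?lerDr//; exact: snd_norm_le.
apply: le_trans (mulmx_norm_le _ _) _; rewrite ler_wpM2l// ler_wpM2l//.
exact: snd_norm_le.
Qed.

Lemma costate_field_diff_linear p w (q : 'cV[R]_n * 'rV[R]_n -> 'rV[R]_n)
    (D : 'cV[R]_n * 'rV[R]_n -> 'cV[R]_n * 'M[R]_n) : linear q -> linear D ->
  linear (fun h => costate_field_diff p w (q h) (D h)).
Proof.
move=> ql Dl a u v; rewrite /costate_field_diff ql Dl; congr (_, _) => /=.
rewrite mulmxDl mulmxDr -!scalemxAl -!scalemxAr scalerN -opprD scalerDr; congr (- _).
by rewrite addrACA.
Qed.

Lemma costate_field_diff_le p w q d :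
  `|costate_field_diff p w q d| <= n%:R * `|w| * `|q| + (1 + n%:R * `|p|) * `|d|.
Proof.
have n0 : 0 <= n%:R :> R by [].
apply: pair_norm_le => /=.
  apply: le_trans (fst_norm_le d) _.
  by rewrite mulrDl mul1r addrCA lerDl addr_ge0// !mulr_ge0.
rewrite normrN; apply: le_trans (ler_normD _ _) _; apply: lerD.
  apply: le_trans (mulmx_norm_le _ _) _; rewrite -!mulrA ler_wpM2l// mulrC ler_wpM2r//.
  exact: snd_norm_le.
apply: le_trans (mulmx_norm_le _ _) _; rewrite mulrA.
by apply: ler_pM; rewrite ?mulr_ge0// ?lerDr//; exact: snd_norm_le.
Qed.
End costate.

Section stages.
Context (R : realType) (k : nat) (s : nat -> R).
Context (s_start : s 0%N = 0) (s_end : s k.+1 = 1)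
  (s_incr : forall j : nat, (j <= k)%N -> s j < s j.+1).

Lemma switch_le i j : (i <= j)%N -> (j <= k.+1)%N -> s i <= s j.
Proof.
elim: j => [|j IH]; first by rewrite leqn0 => /eqP ->.
rewrite leq_eqVlt => /orP[/eqP -> //|]; rewrite ltnS => ij jk.
by apply: le_trans (IH ij (ltnW jk)) _; apply/ltW/s_incr.
Qed.

(** If no stage contained t, then s_i <= t would follow for all i by induction,
    and the last stage would contain t. *)
Lemma stageP (t : R) : 0 <= t -> t <= 1 ->
  (stage k s t <= k)%N /\ s (stage k s t) <= t <= s (stage k s t).+1.
Proof.
move=> t0 t1; rewrite /stage; case: pickP => [j jP|none]; first by rewrite -ltnS ltn_ord.
suff H i : (i <= k.+1)%N -> s i <= t.
  have := none ord_max; rewrite /= s_end t1 andbT => /negP[]; apply: H.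
  by [].
elim: i => [|i IH] ik; first by rewrite s_start.
by have := none (Ordinal ik); rewrite /= IH ?(ltnW ik)//= => /negbT; rewrite -ltNge => /ltW.
Qed.

Lemma stage_eq j (t : R) : (j <= k)%N -> s j < t -> t < s j.+1 -> stage k s t = j.
Proof.
move=> jk sj tj.
have [t0 t1] : 0 <= t /\ t <= 1.
  split; first by rewrite -s_start (le_trans _ (ltW sj))// switch_le// (leq_trans jk).
  by rewrite -s_end (le_trans (ltW tj))// switch_le.
have [ik /andP[si ti]] := stageP t0 t1; set i := stage k s t in ik si ti *.
apply/eqP; rewrite eqn_leq; apply/andP; split; rewrite leqNgt; apply/negP => ij.
  by have := switch_le ij (leq_trans ik (leqnSn _)); rewrite leNgt (le_lt_trans si tj).
by have := switch_le ij (leq_trans jk (leqnSn _)); rewrite leNgt (lt_le_trans sj ti).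
Qed.

Definition switches : set R := [set s j | j in [set j | (j <= k.+1)%N]].

Lemma finite_switches : finite_set switches.
Proof. by apply: finite_image; rewrite (_ : [set _ | _] = `I_k.+2). Qed.

Lemma stage_interior (t : R) : 0 <= t -> t <= 1 -> ~ switches t ->
  [/\ (stage k s t <= k)%N, s (stage k s t) < t & t < s (stage k s t).+1].
Proof.
move=> t0 t1 tS; have [ik /andP[si ti]] := stageP t0 t1; split => //.
  rewrite lt_neqAle si andbT; apply/eqP => e; apply: tS; exists (stage k s t) => //=.
  exact: leq_trans ik _.
by rewrite lt_neqAle ti andbT; apply/eqP => e; apply: tS; exists (stage k s t).+1.
Qed.
End stages.

Lemma derivative_onS (R : realType) (V W : normedModType R) (A B : set V) (g : V -> W)
    (D : V -> {linear V -> W}) : B `<=` A -> derivative_on A g D -> derivative_on B g D.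
Proof.
move=> BA gD v Bv; apply/eqoP => e e0.
have /eqoP/(_ _ e0) := gD v (BA _ Bv).
by apply: (@filterS _ (nbhs v)) => v' H Bv'; apply: H; exact: BA.
Qed.

Lemma continuous_dom (R : realType) (V V1 V2 : normedModType R) (g : R -> V)
    (g1 : R -> V1) (g2 : R -> V2) (K t : R) :
  {for t, continuous g1} -> {for t, continuous g2} ->
  (\forall s \near t, `|g s - g t| <= K * (`|g1 s - g1 t| + `|g2 s - g2 t|)) ->
  {for t, continuous g}.
Proof.
move=> c1 c2 H; apply/cvgrPdist_lt => e e0.
have K0 : 0 < `|K| + 1 by rewrite ltr_wpDl.
have e'0 : 0 < e / (2 * (`|K| + 1)) by rewrite divr_gt0// mulr_gt0.
have /cvgrPdist_lt /(_ _ e'0) h1 := c1; have /cvgrPdist_lt /(_ _ e'0) h2 := c2.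
near=> s0; rewrite distrC.
have hs1 : `|g1 t - g1 s0| < e / (2 * (`|K| + 1)) by near: s0; exact: h1.
have hs2 : `|g2 t - g2 s0| < e / (2 * (`|K| + 1)) by near: s0; exact: h2.
have hs : `|g s0 - g t| <= K * (`|g1 s0 - g1 t| + `|g2 s0 - g2 t|) by near: s0.
rewrite distrC in hs1; rewrite distrC in hs2.
apply: le_lt_trans hs _.
apply: (@le_lt_trans _ _ ((`|K| + 1) * (`|g1 s0 - g1 t| + `|g2 s0 - g2 t|))).
  by rewrite ler_wpM2r ?addr_ge0// (le_trans (ler_norm K))// lerDl.
have -> : e = (`|K| + 1) * (e / (2 * (`|K| + 1)) + e / (2 * (`|K| + 1))) by field; lra.
by rewrite ltr_pM2l// ltrD.
Unshelve. all: by end_near. Qed.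

(** * Regularity of the coupled field *)

Lemma within_itv_continuous_at (R : realType) (V : topologicalType) (g : R -> V) (a b t : R) :
  {within `[a, b], continuous g} -> a < t -> t < b -> {for t, continuous g}.
Proof.
move=> /subspace_continuousP gc at_ tb.
have ot : nbhs t `[a, b]%classic.
  apply/nbhs_ballP; exists (Num.min (t - a) (b - t)) => /=; first by rewrite lt_min; lra.
  move=> s; rewrite /ball/= lt_min !ltr_norml in_itv/= => /andP[]; lra.
have := gc t (nbhs_singleton ot); rewrite within_interior//.
Qed.

Lemma within_pair_id (R : realType) (V : normedModType R) (A : set R) (u : R -> V) :
  {within A, continuous u} -> {within A, continuous (fun t => (u t, t))}.
Proof.
move=> /subspace_continuousP uc; apply/subspace_continuousP => t At.
apply/cvgrPdist_lt => e e0.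
have h1 : \forall r \near within A (nbhs t), `|u t - u r| < e.
  by have /cvgrPdist_lt := uc t At; exact.
have h2 : \forall r \near within A (nbhs t), `|t - r| < e.
  by apply/nbhs_ballP; exists e => // r tr _.
near=> r; rewrite prod_normE/= gt_max; apply/andP; split; near: r; [exact: h1|exact: h2].
Unshelve. all: by end_near. Qed.

Lemma is_derive_pair_eps (R : realType) (V W : normedModType R) (g1 : R -> V) (g2 : R -> W)
    (t : R) v1 v2 :
  is_derive t 1 g1 v1 /\ is_derive t 1 g2 v2 <->
  is_derive t 1 (fun t => (g1 t, g2 t)) (v1, v2).
Proof.
split.
  move=> [/is_derive_epsP D1 /is_derive_epsP D2]; apply/is_derive_epsP => e e0.
  have [d1 d10 H1] := D1 e e0; have [d2 d20 H2] := D2 e e0.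
  exists (Num.min d1 d2); first by rewrite lt_min d10.
  by move=> s; rewrite lt_min => /andP[/H1 h1 /H2 h2]; apply: pair_norm_le.
move=> /is_derive_epsP D; split; apply/is_derive_epsP => e e0; have [d d0 H] := D e e0;
  exists d => // s /H; apply: le_trans.
- exact: (fst_norm_le ((g1 s, g2 s) - (g1 t, g2 t) - (s - t) *: (v1, v2))).
- exact: (snd_norm_le ((g1 s, g2 s) - (g1 t, g2 t) - (s - t) *: (v1, v2))).
Qed.

Lemma is_derive_mx_entries (R : realType) m n (g : R -> 'M[R]_(m, n)) (t : R) (v : 'M[R]_(m, n)) :
  (forall i j, is_derive t 1 (fun t => g t i j) (v i j)) -> is_derive t 1 g v.
Proof.
move=> H; have gd : derivable g t 1 by apply/derivable_mxP => i j; case: (H i j).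
split => //; rewrite derive_mx//; apply/matrixP => i j; rewrite mxE.
by have := H i j; move=> [].
Qed.

Section coupled.
Context (R : realType) (n m k : nat)
  (f : 'cV[R]_n -> 'cV[R]_m -> 'cV[R]_n)
  (phi : nat -> 'cV[R]_n -> 'rV[R]_n -> R -> 'cV[R]_m) (s : nat -> R).

Local Notation state := ('cV[R]_n * 'rV[R]_n)%type.

Definition coupled_field (v : state) (t : R) : state :=
  costate_field v.2 (F k f phi s v.1 v.2 t, Fx k f phi s v.1 v.2 t).

Lemma coupled_solutionP x0 p0 T x p : coupled_solution k f phi s x0 p0 T x p <->
  ode_solution coupled_field (x0, p0) T (fun t => (x t, p t)).
Proof.
have E v t : (T *: F k f phi s v.1 v.2 t, - T *: (v.2 *m Fx k f phi s v.1 v.2 t)) =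
    T *: coupled_field v t.
  by congr (_, _); rewrite /= scalerN scaleNr.
split.
  move=> [xac pac x0E p0E dxp]; split; [|by rewrite x0E p0E|].
    apply: (@abs_continuous_dom _ _ _ _ _ x p 1) => // u v _ _ _; rewrite mul1r.
    by apply: pair_norm_le; rewrite /= ?lerDl ?lerDr.
  apply: ae_mono dxp => t dxpt t01; rewrite -E; apply/is_derive_pair_eps; exact: dxpt.
move=> [zac z0 dz]; split.
- apply: (@abs_continuous_dom _ _ _ _ _ _ _ 1 _ _ zac zac) => u v _ _ _; rewrite mul1r.
  by apply: le_trans (fst_norm_le ((x v, p v) - (x u, p u))) _; rewrite lerDl.
- apply: (@abs_continuous_dom _ _ _ _ _ _ _ 1 _ _ zac zac) => u v _ _ _; rewrite mul1r.
  by apply: le_trans (snd_norm_le ((x v, p v) - (x u, p u))) _; rewrite lerDl.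
- by case: z0.
- by case: z0.
apply: ae_mono dz => t dzt t01; apply/is_derive_pair_eps.
by have := E (x t, p t) t; move=> /= ->; exact: dzt.
Qed.

Context (xbar : R -> 'cV[R]_n) (pbar : R -> 'rV[R]_n).
Context (s_start : s 0%N = 0) (s_end : s k.+1 = 1)
  (s_incr : forall j : nat, (j <= k)%N -> s j < s j.+1).

Let z (t : R) : state := (xbar t, pbar t).

Definition stage_data (j : nat) (v : state * R) : ('cV[R]_n * 'M[R]_n)%type :=
  (fj f phi j v.1.1 v.1.2 v.2, fjx f phi j v.1.1 v.1.2 v.2).

Definition stage_tube (rho : R) (j : nat) : set (state * R) :=
  tube xbar pbar rho (s j) (s j.+1).

(** Regularity of each stage on the part of the tube above its own interval,
    with constants common to all stages; [sr_op], [sr_data] and [sr_costate]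
    bound the reference trajectory and the differential along it. *)
Record stage_regularity (rho L K Pm : R)
    (D : nat -> state * R -> {linear (state * R)%type -> ('cV[R]_n * 'M[R]_n)%type}) : Prop := {
  sr_rho : 0 < rho;
  sr_L : 0 <= L;
  sr_K : 0 <= K;
  sr_Pm : 0 <= Pm;
  sr_der : forall j, (j <= k)%N -> derivative_on (stage_tube rho j) (stage_data j) (D j);
  sr_lip : forall j t (chi chi' h : state), (j <= k)%N ->
    stage_tube rho j (chi, t) -> stage_tube rho j (chi', t) ->
    `|D j (chi, t) (h, 0) - D j (chi', t) (h, 0)| <= L * `|chi - chi'| * `|h|;
  sr_op : forall j t, (j <= k)%N -> s j <= t -> t <= s j.+1 -> state_op_bound (D j (z t, t)) <= K;
  sr_data : forall j t, (j <= k)%N -> s j <= t -> t <= s j.+1 -> `|stage_data j (z t, t)| <= K;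
  sr_costate : forall t : R, 0 <= t -> t <= 1 -> `|pbar t| <= Pm }.

Lemma stage_le01 j (t : R) : (j <= k)%N -> s j <= t -> t <= s j.+1 -> 0 <= t /\ t <= 1.
Proof.
move=> jk sj tj; split.
  by rewrite -s_start (le_trans _ sj)// (switch_le s_incr)// (leq_trans jk).
by rewrite -s_end (le_trans tj)// (switch_le s_incr).
Qed.

Lemma subitv_stage j : (j <= k)%N -> `[s j, s j.+1] `<=` `[0, 1].
Proof.
move=> jk t /=; rewrite !in_itv/= => /andP[sj tj].
by have [-> ->] := stage_le01 jk sj tj.
Qed.

(** The constants exist because the differential and the data are continuous
    along the compact reference curve over each of the finitely many stages. *)
Lemma state_regularity_stages : {within `[0, 1], continuous z} ->
  state_regularity k f phi s xbar pbar ->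
  exists rho L K Pm D, stage_regularity rho L K Pm D.
Proof.
move=> zc [rho [sm [sp [L [rho0 sm0 spk smsp Hj]]]]].
have sub j : (j <= k)%N -> stage_tube rho j `<=` tube xbar pbar rho (sm j) (sp j.+1).
  move=> jk v [/andP[sv vs] vr]; split => //.
  have smj : sm j <= s j.
    case: j jk {sv vs} => [|j] jk; first by rewrite sm0 s_start.
    by have [/andP[_ /ltW]] := smsp j.+1 jk.
  have spj : s j.+1 <= sp j.+1.
    case: (leqP j.+1 k) => jk'.
      by have [_ /andP[/ltW]] := smsp j.+1 jk'.
    by have -> : j = k by [apply/eqP; rewrite eqn_leq jk]; rewrite spk s_end.
  by rewrite (le_trans smj sv) (le_trans vs spj).
have [D DP] := choice (fun j => Hj (minn j k) (geq_minr j k)).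
have D1 j : (j <= k)%N -> derivative_on (stage_tube rho j) (stage_data j) (D j).
  by move=> jk; have [[+ _] _] := DP j; rewrite (minn_idPl jk); apply: derivative_onS; exact: sub.
have D2 j h : (j <= k)%N -> {within stage_tube rho j, continuous (fun v => D j v h)}.
  move=> jk; have [[_ DC] _] := DP j; move: (DC h); rewrite (minn_idPl jk) => {}DC.
  exact: (continuous_subspaceW (sub j jk) DC).
have c01 : {within `[0, 1], continuous (fun t : R => (z t, t))}.
  exact: within_pair_id zc.
have curve j : (j <= k)%N -> {within `[s j, s j.+1], continuous (fun t => (z t, t))}.
  by move=> jk; exact: (continuous_subspaceW (subitv_stage jk) c01).
have incurve j t : (j <= k)%N -> [set` `[s j, s j.+1]] t -> stage_tube rho j (z t, t).
  by move=> jk; rewrite /= in_itv/= => st; split => //=; rewrite subrr normr0 ltW.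
have boundD j h : exists M, (j <= k)%N -> forall t, s j <= t -> t <= s j.+1 -> `|D j (z t, t) h| <= M.
  have [jk|_] := boolP (j <= k)%N; last by exists 0.
  have [M MP] := within_bounded (within_comp (D2 j h jk) (curve j jk) (fun t => incurve j t jk)).
  by exists M.
have boundg j : exists M, (j <= k)%N -> forall t, s j <= t -> t <= s j.+1 -> `|stage_data j (z t, t)| <= M.
  have [jk|_] := boolP (j <= k)%N; last by exists 0.
  have [M MP] := within_bounded (within_comp (derivative_on_within (D1 j jk)) (curve j jk)
    (fun t => incurve j t jk)).
  by exists M.
have [MD MDP] := choice (fun jh : nat * (state * R) => boundD jh.1 jh.2).
have [Mg MgP] := choice boundg.
have [Pm PmP] := within_bounded zc.
pose opM j := \sum_i MD (j, ((delta_mx i 0, 0), 0)) + \sum_i MD (j, ((0, delta_mx 0 i), 0)) +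
  MD (j, (0, 1)).
(* A sum over the stages serves as a common bound. *)
pose K := \sum_(j < k.+1) (`|opM j| + `|Mg j|).
have Kj j : (j <= k)%N -> `|opM j| + `|Mg j| <= K.
  by move=> jk; rewrite /K (bigD1 (Ordinal (jk : (j < k.+1)%N)))//= lerDl sumr_ge0.
exists rho, `|L|, K, `|Pm|, D; split => //.
- by rewrite sumr_ge0// => j _; rewrite addr_ge0.
- move=> j t chi chi' h jk /(sub _ jk) A1 /(sub _ jk) A2.
  have [_ /(_ t chi chi' h)] := DP j; rewrite (minn_idPl jk) => /(_ A1 A2) /le_trans; apply.
  by rewrite -!mulrA ler_wpM2r ?mulr_ge0// ler_norm.
- move=> j t jk sj tj; apply: le_trans (Kj j jk); apply: ler_wpDr => //.
  apply: le_trans (ler_norm _); rewrite /state_op_bound /opM !lerD//.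
  + by apply: ler_sum => i _; exact: (MDP (j, _)).
  + by apply: ler_sum => i _; exact: (MDP (j, _)).
  + exact: (MDP (j, _)).
- move=> j t jk sj tj; apply: le_trans (Kj j jk); apply: ler_wpDl => //.
  by apply: le_trans (ler_norm _); exact: MgP.
move=> t t0 t1; apply: le_trans (ler_norm _); apply: le_trans (PmP t t0 t1).
exact: (snd_norm_le (z t)).
Qed.

Context (rho L K Pm : R)
  (D : nat -> state * R -> {linear (state * R)%type -> ('cV[R]_n * 'M[R]_n)%type}).
Context (sr : stage_regularity rho L K Pm D).

Let data (v : state) (t : R) := stage_data (stage k s t) (v, t).
Let Ddata (t : R) (h : state) := D (stage k s t) (z t, t) (h, 0).
Let Lg : R := K + L * rho.

Let rho_ge0 : 0 <= rho. Proof. exact/ltW/(sr_rho sr). Qed.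
Let Lg0 : 0 <= Lg.
Proof. by rewrite addr_ge0 ?(sr_K sr)// mulr_ge0// (sr_L sr). Qed.

Let in_tube t v : 0 <= t -> t <= 1 -> `|v - z t| <= rho -> stage_tube rho (stage k s t) (v, t).
Proof. by move=> t0 t1 vr; have [_ st] := stageP s_start s_end t0 t1. Qed.

Let z_in_ball t : `|z t - z t| <= rho. Proof. by rewrite subrr normr0. Qed.

Let segment_in_ball (c v w : state) (sg : R) : 0 <= sg -> sg <= 1 ->
  `|v - c| <= rho -> `|w - c| <= rho -> `|v + sg *: (w - v) - c| <= rho.
Proof.
move=> s0 s1 vc wc.
have -> : v + sg *: (w - v) - c = (1 - sg) *: (v - c) + sg *: (w - c).
  have wv : w - v = (w - c) - (v - c) by rewrite opprB addrA subrK.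
  by rewrite addrAC wv scalerBr [_ *: (w - c) - _]addrC addrA scalerBl scale1r.
apply: le_trans (ler_normD _ _) _; rewrite !normrZ ger0_norm ?subr_ge0// (ger0_norm s0).
have h1 : (1 - sg) * `|v - c| <= (1 - sg) * rho by rewrite ler_wpM2l// subr_ge0.
have h2 : sg * `|w - c| <= sg * rho by rewrite ler_wpM2l.
lra.
Qed.

Let Ddata_le t h : 0 <= t -> t <= 1 -> `|Ddata t h| <= K * `|h|.
Proof.
move=> t0 t1; have [jk /andP[sj tj]] := stageP s_start s_end t0 t1.
apply: le_trans (state_op_boundP _ _) _.
have -> : `|(h, 0 : R)| = `|h| by rewrite prod_normE/= normr0 max_l.
by rewrite ler_wpM2r// (sr_op sr).
Qed.

Let data_taylor t v : 0 <= t -> t <= 1 -> `|v - z t| <= rho ->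
  `|data v t - data (z t) t - Ddata t (v - z t)| <= L * `|v - z t| ^+ 2.
Proof.
move=> t0 t1 vr; have [jk _] := stageP s_start s_end t0 t1.
rewrite expr2 mulrA; apply: (segment_taylor (sr_der sr jk)) => //.
- exact: (sr_L sr).
- by move=> chi chi' h; exact: (sr_lip sr).
- exact: in_tube.
move=> sg sg0 sg1; split; first by apply: in_tube => //; exact: segment_in_ball.
by rewrite addrAC subrr add0r normrZ ger0_norm// ler_piMl.
Qed.

Let data_lip t v w : 0 <= t -> t <= 1 -> `|v - z t| <= rho -> `|w - z t| <= rho ->
  `|data w t - data v t| <= Lg * `|w - v|.
Proof.
move=> t0 t1 vr wr; have [jk _] := stageP s_start s_end t0 t1.
have h1 : `|data w t - data v t - Ddata t (w - v)| <= L * rho * `|w - v|.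
  apply: (segment_taylor (sr_der sr jk)) => //.
  - exact: (sr_L sr).
  - by move=> chi chi' h; exact: (sr_lip sr).
  - exact: in_tube.
  by move=> sg sg0 sg1; have := segment_in_ball sg0 sg1 vr wr; split => //; exact: in_tube.
rewrite -[data w t - _](subrK (Ddata t (w - v))); apply: le_trans (ler_normD _ _) _.
by rewrite /Lg addrC mulrDl lerD// Ddata_le.
Qed.

Let z_data_le t : 0 <= t -> t <= 1 -> `|data (z t) t| <= K.
Proof.
move=> t0 t1; have [jk /andP[sj tj]] := stageP s_start s_end t0 t1.
exact: (sr_data sr).
Qed.

Let data_le t v : 0 <= t -> t <= 1 -> `|v - z t| <= rho -> `|data v t| <= K + Lg * rho.
Proof.
move=> t0 t1 vr; rewrite -[data v t](subrK (data (z t) t)) addrC.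
apply: le_trans (ler_normD _ _) _; apply: lerD; first exact: z_data_le.
by apply: le_trans (data_lip _ _ _ vr) _ => //; rewrite ler_wpM2l.
Qed.

Let costate_le t (v : state) : 0 <= t -> t <= 1 -> `|v - z t| <= rho -> `|v.2| <= Pm + rho.
Proof.
move=> t0 t1 vr; rewrite -[v.2](subrK (z t).2) addrC.
apply: le_trans (ler_normD _ _) _; apply: lerD; first exact: (sr_costate sr).
exact: le_trans (snd_norm_le (v - z t)) vr.
Qed.

Let n0 : 0 <= n%:R :> R. Proof. by []. Qed.

Let field_le t v : 0 <= t -> t <= 1 -> `|v - z t| <= rho ->
  `|coupled_field v t| <= (1 + n%:R * (Pm + rho)) * (K + Lg * rho).
Proof.
move=> t0 t1 vr; have := costate_field_dist 0 v.2 0 (data v t).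
have -> : costate_field (0 : 'rV[R]_n) (0 : 'cV[R]_n * 'M[R]_n) = 0.
  by rewrite /costate_field mul0mx oppr0.
rewrite !subr0 normr0 mulr0 mul0r addr0 => /le_trans; apply.
apply: ler_pM => //.
  by rewrite lerD2l ler_wpM2l// (costate_le t0 t1).
exact: data_le.
Qed.

(** Off the switching points the stage is locally constant, and the stage data
    are continuous on the tube. *)
Lemma coupled_field_continuous (u : R -> state) : {within `[0, 1], continuous u} ->
  (forall t : R, 0 <= t -> t <= 1 -> `|u t - z t| <= rho) ->
  forall t, 0 < t -> t < 1 -> ~ switches k s t ->
  {for t, continuous (fun t => coupled_field (u t) t)}.
Proof.
move=> uc urho t t0 t1 tS.
have [jk sj tj] := stage_interior s_start s_end (ltW t0) (ltW t1) tS.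
set j := stage k s t in jk sj tj.
have c01 : {within `[0, 1], continuous (fun t : R => (u t, t))}.
  exact: within_pair_id uc.
have curve : {within `[s j, s j.+1], continuous (fun t => (u t, t))}.
  exact: (continuous_subspaceW (subitv_stage jk) c01).
have dc : {for t, continuous (fun t => stage_data j (u t, t))}.
  apply: (within_itv_continuous_at _ sj tj).
  apply: (within_comp (derivative_on_within (sr_der sr jk)) curve) => r /=.
  rewrite in_itv/= => sjr; split => //=; apply: urho;
  by case/andP: sjr => sr' rs; have [] := stage_le01 jk sr' rs.
have uct : {for t, continuous u} by exact: (within_itv_continuous_at uc).
apply: (continuous_dom (K := 1 + n%:R * (Pm + rho) + n%:R * `|stage_data j (u t, t)|) dc uct).
near=> r.
have [rj1 rj2] : s j < r /\ r < s j.+1.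
  by split; near: r; [exact: lt_nbhsr|exact: lt_nbhsl].
have rj : stage k s r = j by exact: (stage_eq s_start s_end s_incr jk).
have [r0 r1] := stage_le01 jk (ltW rj1) (ltW rj2).
rewrite /coupled_field /F /Fx rj -/j.
apply: le_trans (costate_field_dist _ _ _ _) _.
rewrite [leRHS]mulrDl mulrDr mulrDr.
have h1 : n%:R * `|(u r).2| <= n%:R * (Pm + rho).
  by rewrite ler_wpM2l// (costate_le r0 r1)// urho.
have h2 : `|(u r).2 - (u t).2| <= `|u r - u t| by exact: (snd_norm_le (u r - u t)).
have Pr : 0 <= n%:R * (Pm + rho) by rewrite mulr_ge0// addr_ge0// (sr_Pm sr).
set d := stage_data j (u t, t); set d' := stage_data j (u r, r).
rewrite -/d -/d'.
have a1 : (1 + n%:R * `|(u r).2|) * `|d' - d| <= (1 + n%:R * (Pm + rho)) * `|d' - d|.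
  by rewrite ler_wpM2r// lerD2l.
have a2 : n%:R * `|d| * `|(u r).2 - (u t).2| <= n%:R * `|d| * `|u r - u t|.
  by rewrite ler_wpM2l// mulr_ge0.
have a3 : 0 <= (1 + n%:R * (Pm + rho)) * `|u r - u t| by rewrite mulr_ge0// addr_ge0.
have a4 : 0 <= n%:R * `|d| * `|d' - d| by rewrite !mulr_ge0.
apply: le_trans (lerD a1 a2) _.
lra.
Unshelve. all: by end_near. Qed.

Lemma coupled_field_diff_linear t : linear (fun h : state =>
  costate_field_diff (pbar t) (stage_data (stage k s t) (z t, t)) h.2
    (D (stage k s t) (z t, t) (h, 0))).
Proof.
apply: costate_field_diff_linear => // a u v.
have -> : (a *: u + v, 0 : R) = a *: (u, 0 : R) + (v, 0) :> state * R.
  by congr (_, _); rewrite /= addr0; symmetry; exact: mulr0.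
by rewrite linearP.
Qed.

(** The differential of the coupled field at the reference trajectory. *)
Definition coupled_field_diff (t : R) : {linear state -> state} :=
  pack_linear (coupled_field_diff_linear t).

Let field_diff_le t h : 0 <= t -> t <= 1 ->
  `|coupled_field_diff t h| <= (n%:R * K + (1 + n%:R * Pm) * K) * `|h|.
Proof.
move=> t0 t1; apply: le_trans (costate_field_diff_le _ _ _ _) _.
rewrite [leRHS]mulrDl; apply: lerD.
  apply: ler_pM => //; [|exact: snd_norm_le].
  by rewrite ler_wpM2l// z_data_le.
rewrite -mulrA; apply: ler_pM => //; last exact: Ddata_le.
by rewrite lerD2l ler_wpM2l// (sr_costate sr).
Qed.

Let field_taylor t v : 0 <= t -> t <= 1 -> `|v - z t| <= rho ->
  `|coupled_field v t - coupled_field (z t) t - coupled_field_diff t (v - z t)| <=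
    ((1 + n%:R * Pm) * L + n%:R * Lg) * `|v - z t| ^+ 2.
Proof.
move=> t0 t1 vr.
have := costate_field_taylor (z t).2 v.2 (data (z t) t) (data v t) (Ddata t (v - z t)).
move=> /le_trans; apply; rewrite [leRHS]mulrDl; apply: lerD.
  rewrite -mulrA; apply: ler_pM => //; last exact: data_taylor.
  by rewrite lerD2l ler_wpM2l// (sr_costate sr).
have -> : n%:R * Lg * `|v - z t| ^+ 2 = n%:R * (`|v - z t| * (Lg * `|v - z t|)) by ring.
rewrite ler_wpM2l//; apply: ler_pM => //; first exact: (snd_norm_le (v - z t)).
exact: data_lip.
Qed.

Let field_lip t v w : 0 <= t -> t <= 1 -> `|v - z t| <= rho -> `|w - z t| <= rho ->
  `|coupled_field v t - coupled_field w t| <=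
    ((1 + n%:R * (Pm + rho)) * Lg + n%:R * (K + Lg * rho)) * `|v - w|.
Proof.
move=> t0 t1 vr wr; have := costate_field_dist w.2 v.2 (data w t) (data v t).
move=> /le_trans; apply; rewrite [leRHS]mulrDl; apply: lerD.
  rewrite -mulrA; apply: ler_pM => //; last exact: data_lip.
  by rewrite lerD2l ler_wpM2l// (costate_le t0 t1).
apply: ler_pM => //.
- by rewrite ler_wpM2l// data_le.
- exact: (snd_norm_le (v - w)).
Qed.

(** Integrate each entry. *)
Lemma coupled_field_primitive (u : R -> state) : {within `[0, 1], continuous u} ->
  (forall t : R, 0 <= t -> t <= 1 -> `|u t - z t| <= rho) ->
  exists P : R -> state, [/\ abs_continuous 0 1 P, P 0 = 0 &
    forall t, 0 < t -> t < 1 -> ~ switches k s t -> is_derive t 1 P (coupled_field (u t) t)].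
Proof.
move=> uc urho; pose G t := coupled_field (u t) t.
pose M := (1 + n%:R * (Pm + rho)) * (K + Lg * rho).
have GM t : 0 <= t -> t <= 1 -> `|G t| <= M by move=> t0 t1; apply: field_le => //; exact: urho.
have M0 : 0 <= M.
  have := sr_Pm sr; have := sr_K sr; have := sr_L sr => L0 K0 Pm0.
  by rewrite /M; do ?[apply: mulr_ge0 | apply: addr_ge0].
have finS := finite_switches k s.
pose Phi (g : R -> R) t := \int[@lebesgue_measure R]_(tau in `[0, t]) g tau.
have prim (c : state -> R) : (forall v w, `|c v - c w| <= `|v - w|) -> c 0 = 0 ->
    [/\ forall r t, 0 <= r -> r <= t -> t <= 1 ->
      `|Phi (c \o G) t - Phi (c \o G) r| <= M * (t - r), Phi (c \o G) 0 = 0 &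
    forall t, 0 < t -> t < 1 -> ~ switches k s t -> is_derive t 1 (Phi (c \o G)) (c (G t))].
  move=> cl c0; apply: primitive_off_finite => //.
    move=> t t0 t1; apply: le_trans (GM t t0 t1).
    by have := cl (G t) 0; rewrite c0 !subr0.
  move=> t t0 t1 tS; have Gc := coupled_field_continuous uc urho t0 t1 tS.
  apply: (continuous_dom (K := 1) Gc Gc).
  by apply/nbhs_ballP; exists 1 => //= r _; rewrite mul1r; apply: le_trans (cl _ _) _; rewrite lerDl.
have coord_col i (v w : state) : `|v.1 i 0 - w.1 i 0| <= `|v - w|.
  have := mx_entry_le (v.1 - w.1) i 0; rewrite !mxE => /le_trans; apply.
  exact: (fst_norm_le (v - w)).
have coord_row i (v w : state) : `|v.2 0 i - w.2 0 i| <= `|v - w|.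
  have := mx_entry_le (v.2 - w.2) 0 i; rewrite !mxE => /le_trans; apply.
  exact: (snd_norm_le (v - w)).
have prim1 i := prim (fun v => v.1 i 0) (coord_col i) (mxE _ _ _ _).
have prim2 i := prim (fun v => v.2 0 i) (coord_row i) (mxE _ _ _ _).
exists (fun t => (\col_i Phi (fun t => (G t).1 i 0) t, \row_i Phi (fun t => (G t).2 0 i) t)); split.
- apply: (@lipschitz_abs_continuous _ _ _ M) => r t r0 rt t1.
  have Mtr : 0 <= M * (t - r) by rewrite mulr_ge0// subr_ge0.
  apply: pair_norm_le; apply: mx_norm_le => // i j; rewrite !mxE.
    by have [+ _ _] := prim1 i; apply.
  by have [+ _ _] := prim2 j; apply.
- congr (_, _); apply/matrixP => i j; rewrite !mxE.
    by have [_ + _] := prim1 i.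
  by have [_ + _] := prim2 j.
move=> t t0 t1 tS; rewrite [coupled_field _ _]surjective_pairing.
apply/is_derive_pair_eps; split; apply: is_derive_mx_entries => i j; rewrite ?ord1.
  under eq_fun do rewrite mxE; have [_ _] := prim1 i; exact.
under eq_fun do rewrite mxE; have [_ _] := prim2 j; exact.
Qed.

Lemma ae_interior : {ae (@lebesgue_measure R), forall t : R, t \in `[0, 1] ->
  [/\ 0 < t, t < 1 & ~ switches k s t]}.
Proof.
have cnt : countable (switches k s) by exact/finite_set_countable/finite_switches.
have null : (@lebesgue_measure R).-negligible (switches k s).
  by apply/negligibleP; [apply: countable_measurable|exact: countable_lebesgue_measure0].
apply: negligibleS null => t /= /not_implyP[]; rewrite in_itv/= => /andP[t0 t1] nd.
apply: contrapT => tS; apply: nd; split => //.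
  by rewrite lt_neqAle t0 andbT; apply/eqP => e; apply: tS; exists 0%N; rewrite ?s_start.
by rewrite lt_neqAle t1 andbT; apply/eqP => e; apply: tS; exists k.+1 => //=; rewrite s_end.
Qed.

Lemma coupled_field_regular : exists L' M',
  regular_field coupled_field z coupled_field_diff rho L' M'.
Proof.
have Pm0 := sr_Pm sr; have K0 := sr_K sr; have L0 := sr_L sr.
pose L1 := n%:R * K + (1 + n%:R * Pm) * K.
pose L2 := (1 + n%:R * Pm) * L + n%:R * Lg.
pose L3 := (1 + n%:R * (Pm + rho)) * Lg + n%:R * (K + Lg * rho).
have [L10 L20 L30] : [/\ 0 <= L1, 0 <= L2 & 0 <= L3].
  by split; rewrite /L1 /L2 /L3; do ?[apply: mulr_ge0 | apply: addr_ge0].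
exists (L1 + L2 + L3), ((1 + n%:R * (Pm + rho)) * (K + Lg * rho)); split.
- exact: (sr_rho sr).
- by apply: addr_ge0 => //; exact: addr_ge0.
- by do ?[apply: mulr_ge0 | apply: addr_ge0].
- move=> t v w t0 t1 vr wr; apply: le_trans (field_lip t0 t1 vr wr) _.
  rewrite ler_wpM2r// -/L3; lra.
- move=> t v t0 t1 vr; apply: le_trans (field_taylor t0 t1 vr) _.
  rewrite ler_wpM2r ?exprn_ge0// -/L2; lra.
- by move=> t t0 t1; exact: field_le.
- move=> t v t0 t1; apply: le_trans (field_diff_le v t0 t1) _.
  rewrite ler_wpM2r// -/L1; lra.
move=> u U ul ur.
have uc : {within `[0, 1], continuous u}.
  exact/abs_continuous_within/(lipschitz_abs_continuous ul).
have [P [Pac P0 dP]] := coupled_field_primitive uc ur; exists P; split => //.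
apply: ae_mono ae_interior => t Ht t01; have [t0 t1 tS] := Ht t01; exact: dP.
Qed.

End coupled.

(** * The adjoint equation as a duality *)

Lemma derive_of_quadratic_remainder (R : realType) (V : normedModType R) (g : V -> R)
    (a e : V) (l c d : R) : 0 < d ->
  (forall h : R, `|h| < d -> `|g (h *: e + a) - g a - h * l| <= c * h ^+ 2) ->
  'D_e g a = l.
Proof.
move=> d0 H; apply/cvg_lim => //; apply/cvgrPdist_le => eps eps0.
have c0 : 0 < `|c| + 1 by rewrite ltr_wpDl.
exists (Num.min d (eps / (`|c| + 1))) => /=; first by rewrite lt_min d0 divr_gt0.
move=> h; rewrite /ball_/= sub0r normrN lt_min => /andP[hd he] h0.
have -> : l - h^-1 *: (g (h *: e + a) - g a) = - (h^-1 * (g (h *: e + a) - g a - h * l)).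
  rewrite -[h^-1 *: _]/(h^-1 * _); move: (g _ - g a) => X.
  by rewrite mulrBr mulrA mulVf// mul1r opprB.
rewrite normrN normrM normfV ler_pdivrMl ?normr_gt0//.
apply: le_trans (H h hd) _; rewrite -real_normK ?num_real// expr2 mulrCA.
rewrite ler_wpM2l//; apply: le_trans (_ : (`|c| + 1) * `|h| <= _).
  by rewrite ler_wpM2r// (le_trans (ler_norm c))// lerDl.
by rewrite mulrC -ler_pdivlMr// ltW.
Qed.

Section duality.
Context (R : realType) (n : nat).
Local Notation state := ('cV[R]_n * 'rV[R]_n)%type.
Local Notation costate := ('rV[R]_n * 'rV[R]_n)%type.

Definition adjoint_pairing (y : costate) (v : state) : R :=
  (y.1 *m v.1 + v.2 *m y.2^T) 0 0.

Lemma adjoint_pairing_bounded : bounded_pairing adjoint_pairing (n%:R + n%:R).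
Proof.
have subE (P Q : 'M[R]_1) : P 0 0 - Q 0 0 = (P - Q) 0 0 by rewrite !mxE.
have scaleE c (P : 'M[R]_1) : c * P 0 0 = (c *: P) 0 0 by rewrite !mxE.
split.
- by rewrite addr_ge0.
- move=> a b v; rewrite /adjoint_pairing subE /= [(_ - _)^T]linearB/= mulmxBl mulmxBr.
  by rewrite opprD addrACA.
- by move=> a v w; rewrite /adjoint_pairing subE /= mulmxBr mulmxBl opprD addrACA.
- move=> c a v; rewrite /adjoint_pairing scaleE /= [(_ *: _)^T]linearZ/=.
  by rewrite -scalemxAl -scalemxAr -scalerDr.
- by move=> c a v; rewrite /adjoint_pairing scaleE /= -scalemxAr -scalemxAl -scalerDr.
move=> a v; rewrite /adjoint_pairing mxE mulrDl; apply: le_trans (ler_normD _ _) _.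
have trle : `|a.2^T| <= `|a.2| by apply: mx_norm_le => // i j; rewrite mxE mx_entry_le.
apply: lerD; apply: le_trans (mx_entry_le _ _ _) _; apply: le_trans (mulmx_norm_le _ _) _;
  rewrite ler_wpM2l//.
  by apply: ler_pM => //; [exact: fst_norm_le|exact: fst_norm_le].
rewrite mulrC; apply: ler_pM => //; [|exact: snd_norm_le].
exact: le_trans trle (snd_norm_le _).
Qed.

Lemma adjoint_pairing_basis (l : state -> R) (y : costate) (v : state) :
  (forall v w, l (v + w) = l v + l w) -> (forall c v, l (c *: v) = c * l v) ->
  (forall i, y.1 0 i = l (delta_mx i 0, 0)) -> (forall i, y.2 0 i = l (0, delta_mx 0 i)) ->
  adjoint_pairing y v = l v.
Proof.
move=> lD lZ y1 y2.
have l0 : l 0 = 0 by rewrite -[X in l X](scale0r 0) lZ mul0r.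
rewrite {2}(state_basis v) lD !(big_morph l lD l0) /adjoint_pairing mxE !mxE.
congr (_ + _); apply: eq_bigr => i _; first by rewrite lZ y1 mulrC.
by rewrite lZ mxE y2.
Qed.
End duality.

Section adjoint.
Context (R : realType) (n m k : nat)
  (f : 'cV[R]_n -> 'cV[R]_m -> 'cV[R]_n)
  (phi : nat -> 'cV[R]_n -> 'rV[R]_n -> R -> 'cV[R]_m) (s : nat -> R).
Context (xbar : R -> 'cV[R]_n) (pbar : R -> 'rV[R]_n).
Context (s_start : s 0%N = 0) (s_end : s k.+1 = 1)
  (s_incr : forall j : nat, (j <= k)%N -> s j < s j.+1).
Local Notation state := ('cV[R]_n * 'rV[R]_n)%type.
Local Notation costate := ('rV[R]_n * 'rV[R]_n)%type.
Local Notation G := (coupled_field k f phi s).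
Let z (t : R) : state := (xbar t, pbar t).
Context (A : R -> {linear state -> state}) (rho L M : R).
Context (rf : regular_field G z A rho L M).

(** The sign in the second component of the coupled field is that of the second
    term of the Hamiltonian. *)
Lemma hamiltonian_pairing (v : state) (y : costate) t :
  hamiltonian k f phi s v.1 v.2 y t = adjoint_pairing y (G v t).
Proof. by rewrite /adjoint_pairing /= mulNmx. Qed.

(** The Taylor bound of the field identifies the partial derivatives of the
    Hamiltonian; [iota] inserts the state or the costate into the pair. *)
Lemma hamiltonian_derive (V : normedModType R) (iota : V -> state) (g : V -> R) (y : costate)
    (t : R) (a e : V) (e' : state) : 0 <= t -> t <= 1 ->
  (forall h : R, iota (h *: e + a) = h *: e' + z t) ->
  (forall v, g v = adjoint_pairing y (G (iota v) t)) ->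
  'D_e g a = adjoint_pairing y (A t e').
Proof.
move=> t0 t1 ie gE; have prP := adjoint_pairing_bounded R n.
have e10 : 0 < `|e'| + 1 by rewrite ltr_wpDl.
have ia : iota a = z t by have := ie 0; rewrite !scale0r !add0r.
apply: (@derive_of_quadratic_remainder _ _ g a e _
  ((n%:R + n%:R) * (`|y| * (L * `|e'| ^+ 2))) (rho / (`|e'| + 1))).
  by rewrite divr_gt0// (rf_rho rf).
move=> h hr; rewrite !gE ie ia -(pr_Zr prP) -!(pr_Br prP) -linearZ/=.
have -> : A t (h *: e') = A t (h *: e' + z t - z t) by rewrite addrK.
apply: le_trans (pr_le prP _ _) _; rewrite -!mulrA ler_wpM2l ?addr_ge0// ler_wpM2l//.
apply: le_trans (rf_taylor rf t0 t1 _) _; rewrite addrK normrZ.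
  move: hr; rewrite ltr_pdivlMr// => /ltW; apply: le_trans.
  by rewrite ler_wpM2l// lerDl.
by rewrite exprMn real_normK ?num_real//; lra.
Qed.

(** A linear functional is determined by its values on the canonical basis, and
    on the basis both sides are partial derivatives of the Hamiltonian. *)
Lemma adjoint_solution_pairing C T (y : R -> costate) :
  adjoint_solution k f phi s C T xbar pbar y ->
  {ae (@lebesgue_measure R), forall t : R, t \in `[0, 1] ->
     exists2 dy, is_derive t 1 y dy &
       forall v, adjoint_pairing dy v = - T * adjoint_pairing (y t) (A t v)}.
Proof.
move=> [_ _ _ dy]; have prP := adjoint_pairing_bounded R n.
have /ae_foralln dy_all : forall j : nat, {ae (@lebesgue_measure R), forall t : R, (j <= k)%N ->
    t \in `]s j, s j.+1[ ->
    is_derive t 1 (fun t' => (y t').1)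
      (- T *: grad_col (fun x' => hamiltonian_j f phi j x' (pbar t) (y t) t) (xbar t)) /\
    is_derive t 1 (fun t' => (y t').2)
      (- T *: grad_row (fun p' => hamiltonian_j f phi j (xbar t) p' (y t) t) (pbar t))}.
  move=> j; have [jk|_] := boolP (j <= k)%N; last by apply: aeW.
  by apply: ae_mono (dy j jk) => t + _.
have := ae_and dy_all (ae_interior s_start s_end); apply: ae_mono => t [dyt int] t01.
have [t0 t1 tS] := int t01.
have [jk sj tj] := stage_interior s_start s_end (ltW t0) (ltW t1) tS.
set j := stage k s t in jk sj tj.
have [] := dyt j jk; first by rewrite in_itv/= sj tj.
set gx := grad_col _ _; set gp := grad_row _ _ => d1 d2.
exists (- T *: gx, - T *: gp).
  have -> : y = (fun t' => ((y t').1, (y t').2)) by apply/funext => t'; exact: surjective_pairing.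
  by apply/is_derive_pair_eps.
move=> v; have -> : (- T *: gx, - T *: gp) = - T *: ((gx, gp) : costate) by [].
rewrite (pr_Zl prP); congr (_ * _).
have pr0 a : adjoint_pairing a (0 : state) = 0.
  by rewrite -[X in adjoint_pairing _ X](subrr 0) (pr_Br prP) subrr.
apply: (@adjoint_pairing_basis _ _ (fun v => adjoint_pairing (y t) (A t v))) => [v' w|c v'|i|i].
- rewrite [A t (_ + _)]linearD -[A t w in LHS]opprK (pr_Br prP) -[- A t w]sub0r (pr_Br prP) pr0.
  by rewrite sub0r opprK.
- by rewrite [A t (_ *: _)]linearZ/= (pr_Zr prP).
- rewrite mxE; apply: (hamiltonian_derive (iota := fun x' => (x', pbar t)) (ltW t0) (ltW t1)).
    by move=> h; congr (_, _); rewrite /= scaler0 add0r.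
  by move=> x'; exact: (hamiltonian_pairing (x', pbar t)).
- rewrite mxE; apply: (hamiltonian_derive (iota := fun p' => (xbar t, p')) (ltW t0) (ltW t1)).
    by move=> h; congr (_, _); rewrite /= scaler0 add0r.
  by move=> p'; exact: (hamiltonian_pairing (xbar t, p')).
Qed.
End adjoint.

(** * The derivative with respect to the terminal time *)

HB.instance Definition _ (R : realType) m n := Complete.on 'M[R]_(m, n).

Lemma grad_colE (R : realType) (n : nat) (C : 'cV[R]_n -> R) (a v : 'cV[R]_n) :
  differentiable C a -> 'd C a v = (grad_col C a *m v) 0 0.
Proof.
move=> Ca; rewrite {1}[v]matrix_sum_delta mxE linear_sum; apply: eq_bigr => i _.
by rewrite big_ord1 linearZ/= mxE -deriveE// mulrC.
Qed.

Lemma cvg_cauchy_quotient (R : realType) (V : completeNormedModType R) (q : R -> V) (d c : R) :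
  0 < d -> (forall h h', h != 0 -> h' != 0 -> `|h| < d -> `|h'| < d ->
    `|q h - q h'| <= c * (`|h| + `|h'|)) -> cvg (q h @[h --> 0^']).
Proof.
move=> d0 H; apply/cauchy_cvgP; apply/cauchyP => e e0.
have c0 : 0 < `|c| + 1 by rewrite ltr_wpDl.
have [r [r0 rd re]] : exists r, [/\ 0 < r, r <= d & r <= e / (2 * (`|c| + 1))].
  exists (Num.min d (e / (2 * (`|c| + 1)))); rewrite lt_min !ge_min !lexx orbT d0.
  by rewrite divr_gt0// mulr_gt0.
have r2 : `|r / 2| = r / 2 by rewrite ger0_norm// divr_ge0// ltW.
have r2n : r / 2 != 0 by rewrite lt0r_neq0// divr_gt0.
exists (q (r / 2)); exists r => //= h; rewrite /ball_/= sub0r normrN => hr h0.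
rewrite -ball_normE/=; apply: le_lt_trans (H _ _ r2n h0 _ _) _; [by rewrite r2; lra|lra|].
rewrite r2; apply: (@le_lt_trans _ _ ((`|c| + 1) * (r / 2 + `|h|))).
  rewrite ler_wpM2r//; first by rewrite addr_ge0// divr_ge0// ltW.
  by rewrite (le_trans (ler_norm c))// lerDl.
apply: (@lt_le_trans _ _ ((`|c| + 1) * (2 * r))); first by rewrite ltr_pM2l//; lra.
by move: re; rewrite ler_pdivlMr ?mulr_gt0//; lra.
Qed.

Theorem mainTheorem5 (R : realType) (n m k : nat)
    (f : 'cV[R]_n -> 'cV[R]_m -> 'cV[R]_n) (C : 'cV[R]_n -> R)
    (phi : nat -> 'cV[R]_n -> 'rV[R]_n -> R -> 'cV[R]_m)
    (s : nat -> R) (x0 : 'cV[R]_n) (p0 : 'rV[R]_n) (Tbar : R)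
    (xbar : R -> 'cV[R]_n) (pbar : R -> 'rV[R]_n)
    (y : R -> 'rV[R]_n * 'rV[R]_n)
    (f_diff : forall z : 'cV[R]_n * 'cV[R]_m,
      differentiable (fun w : 'cV[R]_n * 'cV[R]_m => f w.1 w.2) z)
    (C_diff : forall x : 'cV[R]_n, differentiable C x)
    (s_start : s 0%N = 0) (s_end : s k.+1 = 1)
    (s_incr : forall j : nat, (j <= k)%N -> s j < s j.+1)
    (bar_sol : coupled_solution k f phi s x0 p0 Tbar xbar pbar)
    (bar_reg : state_regularity k f phi s xbar pbar)
    (y_sol : adjoint_solution k f phi s C Tbar xbar pbar y) :
  (* near Tbar the system has exactly one solution on [0, 1], so that x(1) and
     C(x(1)) are well-defined functions of T *)
  (\forall T \near Tbar, exists (x : R -> 'cV[R]_n) (p : R -> 'rV[R]_n),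
     coupled_solution k f phi s x0 p0 T x p /\
     forall (x' : R -> 'cV[R]_n) (p' : R -> 'rV[R]_n),
       coupled_solution k f phi s x0 p0 T x' p' ->
       forall t : R, 0 <= t <= 1 -> x' t = x t /\ p' t = p t) /\
  forall (x : R -> R -> 'cV[R]_n) (p : R -> R -> 'rV[R]_n),
    (\forall T \near Tbar, coupled_solution k f phi s x0 p0 T (x T) (p T)) ->
    let x1 := fun T : R => x T 1 in
    let CT := fun T : R => C (x T 1) in
    let H := fun tau : R =>
      hamiltonian k f phi s (xbar tau) (pbar tau) (y tau) tau in
    [/\ derivable x1 Tbar 1,
        derivable CT Tbar 1,
        (@lebesgue_measure R).-integrable `[0, 1] (EFin \o H),
        derive1 CT Tbar = (grad_col C (xbar 1) *m derive1 x1 Tbar) 0 0 &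
        (grad_col C (xbar 1) *m derive1 x1 Tbar) 0 0
          = \int[@lebesgue_measure R]_(tau in `[0, 1]) H tau].
Proof.
pose z t := (xbar t, pbar t); pose G := coupled_field k f phi s.
have z0E : (x0, p0) = z 0 by case: bar_sol => _ _ <- <- _.
have zsol : ode_solution G (z 0) Tbar z by rewrite -z0E; apply/coupled_solutionP.
have [zac _ _] := zsol; have zc := abs_continuous_within zac.
have [rho [L0 [K [Pm [D sr]]]]] := state_regularity_stages s_start s_end s_incr zc bar_reg.
have [L [M rf]] := coupled_field_regular s_start s_end s_incr sr.
set A := coupled_field_diff _ _ _ _ _ _ _ in rf.
have gam0 : 0 < gronwall_factor L Tbar by exact: expR_gt0.
have rho0 := rf_rho rf; have M0 := rf_M rf.
pose a := rho / gronwall_factor L Tbar.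
have a0 : 0 < a by rewrite divr_gt0.
have arho : a * gronwall_factor L Tbar = rho by rewrite divfK// lt0r_neq0.
have Ta T : close_param rho L M Tbar T -> `|T - Tbar| * M <= a.
  move=> [_ Tr]; rewrite ler_pdivlMr//; apply: le_trans Tr.
  by rewrite ler_wpM2r ?(ltW gam0)// ler_wpM2l// lerDl.
have stays T u : close_param rho L M Tbar T -> ode_solution G (z 0) T u ->
    forall t, 0 <= t -> t <= 1 -> `|u t - z t| <= rho.
  move=> Tc sol t t0 t1; rewrite -{1}arho.
  apply: (solution_deviation rf zsol Tc.1 a0 (Ta T Tc) _ sol) => //; by rewrite arho.
have uniq T u v : close_param rho L M Tbar T -> ode_solution G (z 0) T u ->
    ode_solution G (z 0) T v -> forall t, 0 <= t -> t <= 1 -> u t = v t.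
  move=> Tc su sv; apply: (solution_unique rf Tc.1 su sv);
    [exact: stays Tc su|exact: stays Tc sv].
have nearT := near_close_param Tbar rf.
split.
  near=> T.
  have Tc : close_param rho L M Tbar T by near: T.
  have arho' : a * gronwall_factor L Tbar <= rho by rewrite arho.
  have cplt : complete_for_halving ('cV[R]_n * 'rV[R]_n)%type.
    by apply: complete_for_halving_prod; exact: complete_for_halvingT.
  have [u usol urho] := picard_existence rf zsol Tc.1 a0 (Ta T Tc) arho' cplt.
  exists (fun t => (u t).1), (fun t => (u t).2).
  have uE : u = (fun t => ((u t).1, (u t).2)) by apply/funext => t; exact: surjective_pairing.
  split; first by apply/coupled_solutionP; rewrite z0E -uE.
  move=> x' p' /coupled_solutionP sol' t /andP[t0 t1].
  rewrite z0E in sol'; have := uniq T _ _ Tc sol' usol t t0 t1.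
  by rewrite [u t]surjective_pairing => -[].
move=> x p nearsol x1 CT H.
pose u T t := (x T t, p T t).
have [d d0 near_d] : exists2 d, 0 < d & forall h, `|h| < d ->
    close_param rho L M Tbar (h + Tbar) /\ ode_solution G (z 0) (h + Tbar) (u (h + Tbar)).
  have [d /= d0 dP] : \forall T \near Tbar, close_param rho L M Tbar T /\ ode_solution G (z 0) T (u T).
    near=> T; split; first by near: T.
    rewrite -z0E; apply/coupled_solutionP; near: T; exact: nearsol.
  exists d; first exact: d0.
  move=> h hd.
  have hb : `|Tbar - (h + Tbar)| < d by rewrite opprD addrCA subrr addr0 normrN.
  exact: (dP (h + Tbar) hb).
have x1Tbar : x1 Tbar = xbar 1.
  have := near_d 0; rewrite normr0 add0r => /(_ d0) [Tc sol].
  by have := uniq _ _ _ Tc sol zsol 1 ler01 (lexx 1) => -[].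
pose q h := h^-1 *: (x1 (h + Tbar) - xbar 1).
have q_cauchy h h' : h != 0 -> h' != 0 -> `|h| < d -> `|h'| < d ->
    `|q h - q h'| <= (second_order_constant L M Tbar + 1) * gronwall_factor L Tbar * (`|h| + `|h'|).
  move=> h0 h'0 /near_d [Tc sol] /near_d [Tc' sol'].
  have neT (r : R) : r != 0 -> r + Tbar != Tbar.
    by move=> r0; rewrite -subr_eq0 addrK.
  have := difference_quotient_cauchy rf zsol Tc Tc' (neT _ h0) (neT _ h'0) sol sol'.
  rewrite !addrK mulrAC; apply: le_trans.
  exact: (fst_norm_le (h^-1 *: (u (h + Tbar) 1 - z 1) - h'^-1 *: (u (h' + Tbar) 1 - z 1))).
have q_cvg : cvg (q h @[h --> 0^']) by exact: cvg_cauchy_quotient d0 q_cauchy.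
have qE : (fun h => h^-1 *: (x1 (h *: 1 + Tbar) - x1 Tbar)) = q.
  by apply/funext => h; rewrite /q x1Tbar [h *: 1]mulr1.
have x1_der : derivable x1 Tbar 1 by rewrite /derivable qE.
set l := derive1 x1 Tbar.
have ql : q h @[h --> 0^'] --> l.
  have <- : lim (q h @[h --> 0^']) = l by rewrite /l derive1E /derive qE.
  exact: q_cvg.
have C1 : differentiable C (x1 Tbar) by [].
have x1_diff : differentiable x1 Tbar := (derivable1_diffP x1 Tbar).1 x1_der.
have CT_diff : differentiable CT Tbar := differentiable_comp x1_diff C1.
have CT_der : derive1 CT Tbar = (grad_col C (xbar 1) *m l) 0 0.
  rewrite derive1E'// (_ : CT = C \o x1)// diff_comp// /= -derive1E'// -/l x1Tbar.
  exact: grad_colE.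
have [yac y11 y12 _] := y_sol.
have prP := adjoint_pairing_bounded R n.
have [Y HY] := within_bounded (abs_continuous_within yac).
have HE t : H t = adjoint_pairing (y t) (G (z t) t) by exact: (hamiltonian_pairing k f phi s (z t)).
have H_bound t : 0 <= t -> t <= 1 -> `|H t| <= (n%:R + n%:R) * (`|Y| * M).
  move=> t0 t1; rewrite HE; apply: le_trans (pr_le prP _ _) _.
  rewrite ler_wpM2l ?addr_ge0//; apply: ler_pM => //; last exact: (rf_bound rf).
  exact: le_trans (HY t t0 t1) (ler_norm _).
have z_tube t : 0 <= t -> t <= 1 -> `|z t - z t| <= rho by move=> _ _; rewrite subrr normr0 ltW.
have H_cont t : 0 < t -> t < 1 -> ~ switches k s t -> {for t, continuous H}.
  move=> t0 t1 tS.
  have Gc := coupled_field_continuous s_start s_end s_incr sr zc z_tube t0 t1 tS.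
  have yc := within_itv_continuous_at (abs_continuous_within yac) t0 t1.
  apply: (continuous_dom (K := (n%:R + n%:R) * (M + `|y t|)) yc Gc).
  near=> r.
  have [r0 r1] : 0 < r /\ r < 1 by split; near: r; [exact: lt_nbhsr|exact: lt_nbhsl].
  rewrite !HE -/G.
  have -> : adjoint_pairing (y r) (G (z r) r) - adjoint_pairing (y t) (G (z t) t) =
      adjoint_pairing (y r - y t) (G (z r) r) + adjoint_pairing (y t) (G (z r) r - G (z t) t).
    by rewrite (pr_Bl prP) (pr_Br prP) addrA subrK.
  apply: le_trans (ler_normD _ _) _.
  apply: le_trans (lerD (pr_le prP _ _) (pr_le prP _ _)) _.
  rewrite -mulrDr -mulrA ler_wpM2l ?addr_ge0//.
  have Gr : `|G (z r) r| <= M by apply: (rf_bound rf); exact: ltW.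
  have h1 : `|y r - y t| * `|G (z r) r| <= `|y r - y t| * M by rewrite ler_wpM2l.
  have h2 : 0 <= `|y t| * `|y r - y t| by rewrite mulr_ge0.
  have h3 : 0 <= M * `|G (z r) r - G (z t) t| by rewrite mulr_ge0.
  rewrite mulrDl !mulrDr; lra.
have finS := finite_switches k s.
have H_int := integrable_off_finite finS H_bound H_cont.
have [Phi_lip Phi0 dPhi] := primitive_off_finite finS H_bound H_cont.
pose Phi (t : R) := \int[@lebesgue_measure R]_(tau in `[0, t]) H tau.
have dPhi_ae : {ae (@lebesgue_measure R), forall t : R, t \in `[0, 1] ->
    is_derive t 1 Phi (adjoint_pairing (y t) (G (z t) t))}.
  apply: ae_mono (ae_interior s_start s_end) => t Ht t01; have [t0 t1 tS] := Ht t01.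
  by rewrite -HE; exact: dPhi.
have Phi_ac : abs_continuous 0 1 Phi by exact: (lipschitz_abs_continuous Phi_lip).
have y_adj := adjoint_solution_pairing s_start s_end rf y_sol.
have [Q HQ] := adjoint_pairing_estimate rf zsol prP yac y_adj Phi_ac Phi0 dPhi_ae.
(* Divide the pairing estimate by h and let h tend to 0. *)
have grad_l : (grad_col C (xbar 1) *m l) 0 0 = Phi 1.
  apply/eqP; rewrite -subr_eq0 -normr_eq0; apply/eqP/le_anti; rewrite normr_ge0 andbT.
  apply/ler_addgt0Pr => e e0; rewrite add0r.
  set g := grad_col C (xbar 1).
  have N0 : 0 < n%:R * `|g| + 1 by rewrite ltr_wpDl// mulr_ge0.
  have e1 : 0 < e / 2 / (n%:R * `|g| + 1) by rewrite !divr_gt0.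
  have Q0 : 0 < `|Q| + 1 by rewrite ltr_wpDl.
  have e2 : 0 < e / 2 / (`|Q| + 1) by rewrite !divr_gt0.
  have /cvgrPdist_lt /(_ _ e1) ql1 := ql.
  have [h [h0 hd he hq]] : exists h, [/\ h != 0, `|h| < d, `|h| < e / 2 / (`|Q| + 1) &
      `|l - q h| < e / 2 / (n%:R * `|g| + 1)].
    apply: (@filter_ex _ (0^' : set_system R)).
    near=> h; split; near: h.
    - exact: nbhs_dnbhs_neq.
    - exact: dnbhs0_lt.
    - exact: dnbhs0_lt.
    - exact: ql1.
  have [Tc sol] := near_d h hd.
  have hT : h + Tbar != Tbar by rewrite -subr_eq0 addrK.
  have := HQ _ _ Tc hT sol; rewrite addrK.
  have -> : adjoint_pairing (y 1) (u (h + Tbar) 1 - z 1) = h * (g *m q h) 0 0.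
    have scaleE (P : 'M[R]_1) : h * (h^-1 *: P) 0 0 = P 0 0.
      by rewrite mxE mulrA divff// mul1r.
    by rewrite /adjoint_pairing y11 y12 trmx0 mulmx0 addr0 /q -scalemxAr scaleE.
  rewrite -mulrBr normrM expr2 mulrCA ler_pM2l ?normr_gt0// => est.
  have -> : (g *m l) 0 0 - Phi 1 = (g *m (l - q h)) 0 0 + ((g *m q h) 0 0 - Phi 1).
    have subE (P P' : 'M[R]_1) : (P - P') 0 0 = P 0 0 - P' 0 0 by rewrite !mxE.
    by rewrite mulmxBr subE addrA subrK.
  apply: le_trans (ler_normD _ _) _; rewrite [e]splitr; apply: lerD.
    apply: le_trans (mx_entry_le _ _ _) _; apply: le_trans (mulmx_norm_le _ _) _.
    move: hq; rewrite ltr_pdivlMr// => /ltW; apply: le_trans.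
    by rewrite mulrA mulrC ler_wpM2l// lerDl.
  apply: le_trans est _; move: he; rewrite ltr_pdivlMr// => /ltW; apply: le_trans.
  by rewrite mulrC ler_wpM2l// (le_trans (ler_norm Q))// lerDl.
split => //.
by apply/derivable1_diffP.
Unshelve. all: by end_near. Qed.
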